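(* Let $N\ge 2$ and let $\mu_1<\mu_2<\cdots<\mu_N<0$ be real numbers. Suppose $u=(u_1,\dots,u_N)\in (H^1(\mathbb{R})\setminus\{0\})^N$ is a solution of $$-u_i''-2\Big(\sum_{j=1}^N u_j^2\Big)u_i=\mu_i u_i\quad\text{in }\mathbb{R},\qquad i=1,\dots,N.$$ Put $\eta_i=\sqrt{-\mu_i}>0$ for $i=1,\dots,N$. Then there exists a vector $a=(a_1,\dots,a_N)\in(\mathbb{R}\setminus\{0\})^N$ such that $$u_i(x)=\frac{a_i e^{\eta_i x}\det\big(I+B^{(i)}M(x)\big)}{\det\big(I+M(x)\big)},\qquad x\in\mathbb{R},\ i=1,\dots,N,$$ where $I$ is the $N\times N$ identity matrix, $$M(x)=\big(m_{jk}(x)\big)_{1\le j,k\le N},\qquad m_{jk}(x)=\frac{a_ja_k}{2\sqrt{\eta_j\eta_k}\,(\eta_j+\eta_k)}e^{(\eta_j+\eta_k)x},$$ and $$B^{(i)}=\operatorname{diag}\Big(\frac{\eta_i-\eta_1}{\eta_i+\eta_1},\frac{\eta_i-\eta_2}{\eta_i+\eta_2},\dots,\frac{\eta_i-\eta_N}{\eta_i+\eta_N}\Big).$$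
   Context: All functions are real-valued. $u\in (H^1(\mathbb{R})\setminus\{0\})^N$ means that every component $u_i$ lies in $H^1(\mathbb{R})$ and is not identically zero. Equations for $H^1$ functions are understood in the distributional sense; $H^1$ solutions are identified with their $C^2$ representatives. *)

(* Defs.v *)
From mathcomp Require Export all_boot all_order all_algebra.
From mathcomp Require Export all_classical all_reals all_analysis.

Set Implicit Arguments.
Unset Strict Implicit.
Unset Printing Implicit Defensive.

Export Order.TTheory GRing.Theory Num.Theory.
Export numFieldNormedType.Exports.

Local Open Scope classical_set_scope.
Local Open Scope ring_scope.

Definition test_function (R : realType) (phi : R -> R) : Prop :=
  (forall (n : nat) (x : R), derivable (phi^`(n))%classic x 1) /\
  compact (closure [set x : R | phi x != 0]).

Definition weak_derivative (R : realType) (f g : R -> R) : Prop :=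
  forall phi : R -> R, test_function phi ->
    (\int[@lebesgue_measure R]_x (f x * (phi^`())%classic x)) =
    - (\int[@lebesgue_measure R]_x (g x * phi x)).

(* Elements of H^1 are represented by square-integrable functions, not by
   classes: equality in H^1 is equality almost everywhere. *)
Definition H1 (R : realType) (f : R -> R) : Prop :=
  f \in Lfun (@lebesgue_measure R) 2%:E /\
  exists g : R -> R,
    g \in Lfun (@lebesgue_measure R) 2%:E /\ weak_derivative f g.

Definition H1_nonzero (R : realType) (f : R -> R) : Prop :=
  H1 f /\ ~ {ae @lebesgue_measure R, forall x, f x = 0}.

(* - u_i'' - 2 (sum_j u_j^2) u_i = mu_i u_i in the distributional sense.
   For u in H^1, which embeds in L^oo, all the integrands are integrable. *)
Definition distributional_solution (R : realType) (N : nat)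
    (mu : 'I_N -> R) (u : 'I_N -> R -> R) : Prop :=
  forall (i : 'I_N) (phi : R -> R), test_function phi ->
    - (\int[@lebesgue_measure R]_x (u i x * (phi^`(2))%classic x))
    - (\int[@lebesgue_measure R]_x
         (2 * (\sum_(j < N) u j x ^+ 2) * u i x * phi x))
    = \int[@lebesgue_measure R]_x (mu i * u i x * phi x).

Definition C2 (R : realType) (f : R -> R) : Prop :=
  (forall x : R, derivable f x 1) /\
  (forall x : R, derivable (f^`())%classic x 1) /\
  continuous (f^`(2))%classic.

Definition C2_representative (R : realType) (f w : R -> R) : Prop :=
  C2 w /\ {ae @lebesgue_measure R, forall x, f x = w x}.

Definition Mmx (R : realType) (N : nat) (eta a : 'I_N -> R) (x : R) : 'M[R]_N :=
  \matrix_(j < N, k < N)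
    (a j * a k / (2 * Num.sqrt (eta j * eta k) * (eta j + eta k))
     * expR ((eta j + eta k) * x)).

Definition Bmx (R : realType) (N : nat) (eta : 'I_N -> R) (i : 'I_N) : 'M[R]_N :=
  diag_mx (\row_(j < N) ((eta i - eta j) / (eta i + eta j))).

(* Main.v *)
From mathcomp Require Import ring lra measurable_realfun.
Require Import Defs.

(* The C^2 representatives [w] and their derivatives tend to 0 at [-oo], and
   there each [w i] is asymptotic to [a i * expR (eta i * x)] for some nonzero
   [a i].  Put [psi i = w i / sqrt (2 eta i)],
   [lam i = a i / sqrt (2 eta i) * expR (eta i * x)], and let [M] be the matrix
   of the [lam j * lam k / (eta j + eta k)].  The defect
   [g = lam - M psi - psi] turns out to solve a linear homogeneous second order
   system whose coefficients decay exponentially at [-oo]; since moreover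
   [expR (- eta i * x) * g i] and [expR (- eta i * x) * g' i] tend to 0,
   Gronwall's lemma gives [g = 0].  Hence [(1 + M) psi = lam], and the
   determinantal formula is Cramer's rule for this system, rewritten by means
   of the displacement equation of the Cauchy-like matrix [M].  The
   representatives come from the du Bois-Reymond lemma: testing a weak
   derivative against smoothed indicators of [[a, b]] at Lebesgue points [a], [b]
   gives [f b - f a] as the integral of the derivative. *)

Set Implicit Arguments.
Unset Strict Implicit.
Unset Printing Implicit Defensive.

Local Open Scope classical_set_scope.
Local Open Scope ring_scope.

(** * Smooth cut-off functions *)

Section calculus.
Context {R : realType}.
Implicit Types (f g : R -> R) (x : R).

Lemma is_derive1D f g x a b : is_derive x 1 f a -> is_derive x 1 g b ->
  is_derive x 1 (fun y => f y + g y) (a + b).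
Proof. exact: is_deriveD. Qed.

Lemma is_derive1B f g x a b : is_derive x 1 f a -> is_derive x 1 g b ->
  is_derive x 1 (fun y => f y - g y) (a - b).
Proof. exact: is_deriveB. Qed.

Lemma is_derive1N f x a : is_derive x 1 f a -> is_derive x 1 (fun y => - f y) (- a).
Proof. exact: is_deriveN. Qed.

Lemma is_derive1M f g x a b : is_derive x 1 f a -> is_derive x 1 g b ->
  is_derive x 1 (fun y => f y * g y) (a * g x + f x * b).
Proof.
move=> fa gb; apply: (@is_derive_eq _ _ _ (f * g)).
by rewrite /GRing.scale /= addrC mulrC.
Qed.

Lemma is_derive1Z f x c a : is_derive x 1 f a -> is_derive x 1 (fun y => c * f y) (c * a).
Proof. exact: is_deriveZ. Qed.

Lemma is_derive1_sum (I : finType) (h : I -> R -> R) x (a : I -> R) :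
  (forall i, is_derive x 1 (h i) (a i)) ->
  is_derive x 1 (fun y => \sum_i h i y) (\sum_i a i).
Proof.
move=> dh; rewrite (_ : (fun y => _) = \sum_i h i); last first.
  by apply/funext => y; rewrite fct_sumE.
by elim/big_ind2 : _ => // [|*]; [exact: is_derive_cst|exact: is_deriveD].
Qed.

Lemma is_derive1_affine x (k c : R) : is_derive x 1 (fun y => k * y + c) k.
Proof.
have := is_derive1D (is_derive1Z k (is_derive_id x 1)) (is_derive_cst c x 1).
by rewrite mulr1 addr0.
Qed.

Lemma is_derive1_chain f g x a b : is_derive (g x) 1 f a -> is_derive x 1 g b ->
  is_derive x 1 (fun y => f (g y)) (a * b).
Proof. exact: is_derive1_comp. Qed.

Lemma is_derive1X f n x a : is_derive x 1 f a ->
  is_derive x 1 (fun y => f y ^+ n) (n%:R * f x ^+ n.-1 * a).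
Proof. by move=> fa; have := is_deriveX n fa; rewrite exprfctE. Qed.

Lemma is_derive1_exp x (k : R) : is_derive x 1 (fun y => expR (k * y)) (k * expR (k * x)).
Proof.
have dk := is_derive1Z k (is_derive_id x 1); rewrite mulr1 in dk.
by rewrite mulrC; exact: (is_derive1_chain (is_derive_expR _) dk).
Qed.

Lemma is_derive_continuous f x a : is_derive x 1 f a -> {for x, continuous f}.
Proof. by move=> [fx _]; apply: differentiable_continuous; apply/derivable1_diffP. Qed.

Lemma is_derive1E f x a : is_derive x 1 f a -> (f^`())%classic x = a.
Proof. by move=> fa; rewrite derive1E; apply: derive_val. Qed.

Lemma near_is_derive f g x a : (\forall y \near x, f y = g y) ->
  is_derive x 1 g a -> is_derive x 1 f a.
Proof.
move=> fg ga.
by apply: near_eq_is_derive ga; near do apply/esym.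
Unshelve. all: by end_near.
Qed.

Lemma is_derive_quadratic f (C : R) : (forall h, `|f h| <= C * h ^+ 2) -> is_derive (0:R) 1 f 0.
Proof.
move=> fC.
have f0 : f 0 = 0.
  by apply/eqP; rewrite -normr_le0 (le_trans (fC _))// expr0n mulr0.
have C0 : 0 <= C by have := fC 1; rewrite expr1n mulr1; apply: le_trans.
have H : h^-1 *: (f (h *: 1 + 0) - f 0) @[h --> 0^'] --> (0:R).
  apply/cvgrPdist_le => /= e e0.
  have C1 : 0 < C + 1 by rewrite ltr_wpDl.
  have eC : 0 < e / (C + 1) by exact: divr_gt0.
  near=> h.
  rewrite sub0r normrN f0 subr0 addr0 /GRing.scale/= mulr1 normrM normfV.
  have h0 : h != 0 by near: h; exact: nbhs_dnbhs_neq.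
  rewrite ler_pdivrMl ?normr_gt0//.
  apply: (le_trans (fC _)).
  rewrite -[h ^+ 2]real_normK ?num_real// expr2 mulrCA ler_wpM2l//.
  have : `|h| <= e / (C + 1) by near: h; apply: dnbhs0_le.
  rewrite ler_pdivlMr// mulrC; apply: le_trans.
  by rewrite ler_wpM2r// lerDl.
by apply: DeriveDef; [apply/cvg_ex; exists 0|exact/cvg_lim].
Unshelve. all: by end_near. Qed.

Definition flat_exp (n : nat) (x : R) : R :=
  if 0 < x then x^-1 ^+ n * expR (- x^-1) else 0.

Lemma flat_exp_quadratic n x : `|flat_exp n x| <= (n.+2)`!%:R * x ^+ 2.
Proof.
rewrite /flat_exp; case: ifPn => [x0|_]; last first.
  by rewrite normr0 mulr_ge0 ?sqr_ge0.
rewrite ger0_norm ?mulr_ge0 ?exprn_ge0 ?expR_ge0 ?invr_ge0 ?(ltW x0)//.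
have xi : 0 <= x^-1 by rewrite invr_ge0 ltW.
have := expR_ge1Dxn n.+1 xi; rewrite expRN => H.
rewrite ler_pdivrMr ?expR_gt0// -mulrA.
have {}H : x^-1 ^+ n.+2 <= (n.+2)`!%:R * expR x^-1.
  rewrite mulrC -ler_pdivrMr ?ltr0n ?fact_gt0//.
  by apply: le_trans H; rewrite lerDr.
rewrite (_ : x^-1 ^+ n = x ^+ 2 * x^-1 ^+ n.+2); last first.
  by rewrite -[n.+2]addn2 exprD mulrCA -exprMn divff ?expr1n ?mulr1// gt_eqF.
by rewrite [leRHS]mulrCA ler_wpM2l// sqr_ge0.
Qed.

Lemma is_derive_flat_exp n x :
  is_derive x 1 (flat_exp n) (flat_exp n.+2 x - n%:R * flat_exp n.+1 x).
Proof.
have [x0|x0|x0] := ltgtP 0 x; last first.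
- rewrite -x0 /flat_exp ltxx mulr0 subr0.
  by apply: is_derive_quadratic; exact: flat_exp_quadratic.
- rewrite /flat_exp !(ltNge 0 x) (ltW x0)/= mulr0 subr0.
  apply: near_is_derive (is_derive_cst 0 x 1).
  near=> y; rewrite ltNge ifF//; apply/negbTE; rewrite negbK.
  by apply/ltW; near: y; exact: lt_nbhsl.
- apply: (@near_is_derive _ (fun y => y^-1 ^+ n * expR (- y^-1))).
    near=> y; rewrite /flat_exp ifT//.
    by near: y; exact: lt_nbhsr.
  have dV : is_derive x 1 (fun y : R => y^-1) (- x ^- 2).
    have := is_deriveV (lt0r_neq0 x0) (is_derive_id x 1).
    by rewrite /GRing.scale/= mulr1.
  have dE := is_derive1_chain (is_derive_expR _) (is_derive1N dV).
  apply: is_derive_eq (is_derive1M (is_derive1X n dV) dE) _.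
  rewrite /flat_exp x0.
  rewrite /= [x^-1 ^+ n.+2]exprS [x^-1 ^+ n.+1]exprS.
  case: n => [|n]; rewrite ?expr0 ?exprS/=; field; rewrite ?lt0r_neq0//.
Unshelve. all: by end_near. Qed.

(* Closing the translates of the flat functions under ring operations and
   inversion gives a class stable under differentiation, so every member of it
   is smooth. *)
Inductive smooth_expr : (R -> R) -> Prop :=
| smooth_cst c : smooth_expr (fun=> c)
| smooth_flat n k c : smooth_expr (fun x => flat_exp n (k * x + c))
| smooth_add f g : smooth_expr f -> smooth_expr g -> smooth_expr (fun x => f x + g x)
| smooth_mul f g : smooth_expr f -> smooth_expr g -> smooth_expr (fun x => f x * g x)
| smooth_inv f : (forall x, f x != 0) -> smooth_expr f -> smooth_expr (fun x => (f x)^-1).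

Lemma smooth_expr_derive f : smooth_expr f ->
  exists2 f', smooth_expr f' & forall x, is_derive x 1 f (f' x).
Proof.
elim=> [c|n k c|{}f g _ [f' sf' ff'] _ [g' sg' gg']
       |{}f g sf [f' sf' ff'] sg [g' sg' gg']|{}f f0 sf [f' sf' ff']].
- by exists (fun=> 0); [exact: smooth_cst|move=> x; exact: is_derive_cst].
- exists (fun x => (flat_exp n.+2 (k * x + c) + (- n%:R) * flat_exp n.+1 (k * x + c)) * k).
    apply: smooth_mul (smooth_cst _); apply: smooth_add; first exact: smooth_flat.
    by apply: smooth_mul; [exact: smooth_cst|exact: smooth_flat].
  move=> x; rewrite mulNr.
  exact: (is_derive1_chain (is_derive_flat_exp _ _) (is_derive1_affine _ _ _)).
- by exists (fun x => f' x + g' x); [exact: smooth_add|move=> x; exact: is_derive1D].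
- exists (fun x => f' x * g x + f x * g' x); last by move=> x; exact: is_derive1M.
  by apply: smooth_add; exact: smooth_mul.
- exists (fun x => -1 * ((f x)^-1 * (f x)^-1) * f' x).
    apply: smooth_mul => //; apply: smooth_mul; first exact: smooth_cst.
    by apply: smooth_mul; exact: smooth_inv.
  move=> x; have := is_deriveV (f0 x) (ff' x).
  by rewrite /GRing.scale/= mulN1r -invfM -expr2.
Qed.

Lemma smooth_expr_derivable f : smooth_expr f ->
  forall n x, derivable (f^`(n))%classic x 1.
Proof.
move=> sf n; elim: n f sf => [|n IH] f sf x; have [f' sf' ff'] := smooth_expr_derive sf.
  by rewrite derive1n0; have [] := ff' x.
rewrite derive1Sn (_ : (f^`())%classic = f'); first exact: IH.
by apply/funext => y; exact: is_derive1E (ff' y).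
Qed.

Lemma smooth_expr_affine f k c : smooth_expr f -> smooth_expr (fun x => f (k * x + c)).
Proof.
elim=> [a|n k' c'|{}f g _ sf _ sg|{}f g _ sf _ sg|{}f f0 _ sf].
- exact: smooth_cst.
- rewrite (_ : (fun x => _) = (fun x => flat_exp n (k' * k * x + (k' * c + c')))).
    exact: smooth_flat.
  by apply/funext => x; congr flat_exp; ring.
- exact: smooth_add.
- exact: smooth_mul.
- by apply: smooth_inv.
Qed.

Lemma exists_smooth_step : exists S : R -> R,
  [/\ smooth_expr S, forall x, x <= 0 -> S x = 0, forall x, 1 <= x -> S x = 1 &
      forall x, 0 <= S x <= 1].
Proof.
have e_ge0 x : 0 <= flat_exp 0 x.
  by rewrite /flat_exp; case: ifP => // _; rewrite expr0 mul1r expR_ge0.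
have e_gt0 x : 0 < x -> 0 < flat_exp 0 x.
  by rewrite /flat_exp => ->; rewrite expr0 mul1r expR_gt0.
have e0 x : x <= 0 -> flat_exp 0 x = 0 by rewrite /flat_exp ltNge => ->.
pose d (x : R) := flat_exp 0 (1 * x + 0) + flat_exp 0 (-1 * x + 1).
have d_gt0 x : 0 < d x.
  rewrite /d mul1r addr0; have [x0|x0] := ltP 0 x.
    by rewrite ltr_pwDl// e_gt0.
  by rewrite ltr_wpDl// e_gt0// mulN1r; lra.
exists (fun x => flat_exp 0 (1 * x + 0) * (d x)^-1); split.
- apply: smooth_mul; first exact: smooth_flat.
  apply: smooth_inv; first by move=> x; rewrite gt_eqF.
  by apply: smooth_add; exact: smooth_flat.
- by move=> x x0; rewrite mul1r addr0 e0// mul0r.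
- move=> x x1; rewrite /d (e0 (-1 * x + 1)) ?addr0 ?mulfV// ?gt_eqF//; last lra.
  by rewrite e_gt0; lra.
- move=> x; rewrite divr_ge0 ?(ltW (d_gt0 x))//= ler_pdivrMr// mul1r.
  by rewrite mul1r /d mul1r lerDl.
Qed.
End calculus.

(** * Weak derivatives *)

Section weak.
Context {R : realType}.
Notation mu := (@lebesgue_measure R).
Implicit Types (f g : R -> R) (x : R).

Definition loc_integrable f :=
  measurable_fun setT f /\ forall a b : R, mu.-integrable `[a, b] (EFin \o f).


Lemma locally_integrable_of f : loc_integrable f -> locally_integrable setT f.
Proof.
move=> [mf fi]; split=> //; first exact: openT.
move=> K _ cK.
have [M [_ MK]] := compact_bounded cK.
have KM : K `<=` `[- (M + 1), M + 1].
  move=> x Kx; rewrite /= in_itv/= -ler_norml; apply: MK => //; lra.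
have /integrableP[_] := fi (- (M + 1)) (M + 1).
apply: le_lt_trans; apply: ge0_subset_integral => //=.
- exact: compact_measurable.
- by apply/measurable_EFinP; apply: measurableT_comp => //; exact: measurable_funTS.
Qed.

Lemma integrable_itv_continuous (a b : R) f : continuous f ->
  mu.-integrable `[a, b] (EFin \o f).
Proof.
move=> cf; apply: continuous_compact_integrable; first exact: segment_compact.
exact: continuous_subspaceT.
Qed.

Lemma integrable_itv_cst (a b c : R) : mu.-integrable `[a, b] (EFin \o (fun=> c)).
Proof. by apply: integrable_itv_continuous; exact: cst_continuous. Qed.

Lemma bounded_itv_continuous (a b : R) f : continuous f ->
  exists M : R, forall x, x \in `[a, b] -> `|f x| <= M.
Proof.
move=> cf; have cf' : {within `[a, b], continuous f} by exact: continuous_subspaceT.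
have /compact_bounded[M [_ mrt]] := continuous_compact cf' (@segment_compact _ a b).
exists (M + 1) => x xab; apply: (mrt (M + 1)); first lra.
by exists x.
Qed.

Lemma Lfun2_loc_integrable f : f \in Lfun mu 2%:E -> loc_integrable f.
Proof.
move=> f2.
have mf : measurable_fun setT f by move: f2; rewrite inE => /andP[]; rewrite inE.
split=> // a b.
have i1 : mu.-integrable `[a, b] (EFin \o (fun x => 1 + f x ^+ 2)).
  have i2 := integrableS measurableT
    (_ : measurable (`[a, b]%classic : set (measurableTypeR R)))
    (@subsetT _ _) (Lfun2_integrable_sqr f2).
  have i1 := integrable_itv_cst a b 1.
  by apply: (integrableD _ i1 (i2 _)); exact: measurable_itv.
apply: le_integrable i1 => //.
  by apply/measurable_EFinP; exact: measurable_funTS.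
move=> x _ /=; rewrite lee_fin [leRHS]ger0_norm ?addr_ge0 ?sqr_ge0//.
rewrite -[f x ^+ 2]real_normK ?num_real//; have := sqr_ge0 (`|f x| - 1); nra.
Qed.

Lemma Rintegral_support (D : set R) f : (forall x, ~ D x -> f x = 0) ->
  \int[mu]_x f x = \int[mu]_(x in D) f x.
Proof.
move=> f0; rewrite [RHS]Rintegral_mkcond; apply: eq_Rintegral => x _.
by rewrite patchE; case: ifPn => //; rewrite notin_setE => /f0.
Qed.

Lemma test_function_itv (phi : R -> R) (a b : R) :
  (forall n x, derivable (phi^`(n))%classic x 1) ->
  (forall x, x \notin `[a, b] -> phi x = 0) -> test_function phi.
Proof.
move=> dphi phi0; split=> //.
apply: (@subclosed_compact _ _ `[a, b]); [exact: closed_closure|exact: segment_compact|].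
rewrite [X in _ `<=` X](closure_id _).1; last exact: itv_closed.
apply: closure_subset => x /= phix.
by apply: contraNT phix => /phi0 ->.
Qed.

Lemma integrable_mul_support f (psi : R -> R) (a b : R) : loc_integrable f ->
  continuous psi -> (forall x, x \notin `[a, b] -> psi x = 0) ->
  mu.-integrable setT (EFin \o (fun x => f x * psi x)).
Proof.
move=> [mf fi] cpsi psi0.
rewrite (_ : _ \o _ = ((EFin \o (fun x => f x * psi x)) \_ `[a, b])); last first.
  apply/funext => x; rewrite /= patchE; case: ifPn => //= xab.
  by rewrite psi0 ?mulr0//; apply: contra xab; rewrite inE.
have [M HM] := bounded_itv_continuous a b cpsi.
have mab : measurable (`[a, b]%classic : set (measurableTypeR R)) by exact: measurable_itv.
have := integrableMr (h := psi) mab _ _ (fi a b).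
rewrite (_ : (_ \* _)%E = EFin \o (fun x => f x * psi x)); last first.
  by apply/funext => x /=; rewrite mulrC.
move=> H; apply/(integrable_mkcond _ mab); apply: H.
  by apply: measurable_funTS; exact: continuous_measurable_fun.
by exists M; split; rewrite ?num_real// => N MN x xab; apply: (le_trans (HM _ xab)); exact: ltW.
Qed.

Section mollifier.
Variables (S s : R -> R) (C : R).
Hypotheses (dS : forall x, is_derive x 1 S (s x)) (cs : continuous s).
Hypotheses (s0 : forall x, x \notin `[0, 1] -> s x = 0) (sC : forall x, `|s x| <= C).
Hypotheses (S0 : S 0 = 0) (S1 : S 1 = 1).

Let rho (k a x : R) := k * s (k * x + - (k * a)).

Lemma mollifier_continuous k a : continuous (rho k a).
Proof.
move=> x; apply: cvgM; first exact: cvg_cst.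
apply: (@continuous_comp _ _ _ (fun x => k * x + - (k * a)) s); last exact: cs.
exact: is_derive_continuous (is_derive1_affine _ _ _).
Qed.

Lemma mollifier_support k a x : 0 < k -> x \notin `[a, a + k^-1] -> rho k a x = 0.
Proof.
move=> k0 xa; rewrite /rho s0 ?mulr0//; apply: contra xa.
rewrite !in_itv/= -mulrBr => /andP[x0 x1].
rewrite pmulr_rge0// subr_ge0 in x0; rewrite x0/= -lerBlDl.
by rewrite -(ler_pM2l k0) mulfV ?gt_eqF.
Qed.

Lemma mollifier_mass k a : 0 < k -> \int[mu]_x rho k a x = 1.
Proof.
move=> k0; rewrite (@Rintegral_support `[a, a + k^-1]); last first.
  by move=> x /negP; exact: mollifier_support.
have aak : a < a + k^-1 by rewrite ltrDl invr_gt0.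
have dF x : is_derive x 1 (fun x => S (k * x + - (k * a))) (rho k a x).
  by rewrite /rho [k * s _]mulrC; exact: (is_derive1_chain (dS _) (is_derive1_affine _ _ _)).
have cF x : {for x, continuous (fun x => S (k * x + - (k * a)))}.
  exact: is_derive_continuous (dF x).
rewrite /Rintegral (continuous_FTC2 (F := fun x => S (k * x + - (k * a))) aak).
- by rewrite subrr S0 mulrDr mulfV ?gt_eqF// addrAC subrr add0r S1 /= subr0.
- exact/continuous_subspaceT/mollifier_continuous.
- split; first by move=> x _; have [] := dF x.
  + exact/cvg_at_right_filter/cF.
  + exact/cvg_at_left_filter/cF.
- by move=> x _; exact: is_derive1E (dF x).
Qed.

Lemma mollify_le f a k : loc_integrable f -> 0 < k ->
  `|\int[mu]_x (f x * rho k a x) - f a| <= 4 * C * fine (davg f a (2 / k)).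
Proof.
move=> lf k0; have [mf fi] := lf.
have k20 : 0 < 2 / k by rewrite divr_gt0.
have C0 : 0 <= C by exact: le_trans (sC 0).
have supp x : ~ ball a (2 / k) x -> rho k a x = 0.
  move=> xB; apply: mollifier_support => //; apply/negP; rewrite in_itv/= => /andP[ax xa].
  apply: xB; rewrite /ball/= ler0_norm ?subr_le0// opprB ltrBlDl.
  by rewrite (le_lt_trans xa)// ltrD2l ltr_pdivlMr// mulVf ?gt_eqF// ltr1n.
have ifr : mu.-integrable setT (EFin \o (fun x => f x * rho k a x)).
  apply: integrable_mul_support => //; first exact: mollifier_continuous.
  by move=> x; exact: (mollifier_support k0).
have ir : mu.-integrable setT (EFin \o rho k a).
  have lc : loc_integrable (fun=> 1).
    by split; [exact: measurable_cst|move=> c d; exact: integrable_itv_cst].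
  have := integrable_mul_support lc (@mollifier_continuous k a)
    (fun x => @mollifier_support k a x k0).
  by under eq_fun do rewrite mul1r.
have iB : mu.-integrable (ball a (2 / k)) (EFin \o (fun x => f x - f a)).
  have iI : mu.-integrable `[a - 2 / k, a + 2 / k] (EFin \o (fun x => f x - f a)).
    apply: (integrableB _ (fi _ _) (integrable_itv_cst _ _ (f a))); exact: measurable_itv.
  apply: integrableS iI => //; first exact: measurable_ball.
  by rewrite ball_itv; exact: subset_itv_oo_cc.
have mB : measurable (ball a (2 / k)) by exact: measurable_ball.
have iBn : mu.-integrable (ball a (2 / k)) (EFin \o (fun x => `|f x - f a|)).
  exact: integrable_norm iB.
rewrite [X in _ - X](_ : f a = \int[mu]_x (f a * rho k a x)); last first.
  by rewrite RintegralZl// mollifier_mass// mulr1.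
rewrite -RintegralB//; last first.
  exact: integrableZl ir.
have eqi : \int[mu]_x (f x * rho k a x - f a * rho k a x) =
   \int[mu]_(x in ball a (2 / k)) ((f x - f a) * rho k a x).
  rewrite -[RHS]Rintegral_support; last by move=> x xB; rewrite supp// mulr0.
  by apply: eq_Rintegral => x _; rewrite mulrBl.
rewrite eqi.
have iBr : mu.-integrable (ball a (2 / k)) (EFin \o (fun x => (f x - f a) * rho k a x)).
  apply: integrableS (measurableT) _ _ _ => //.
  have := integrableB measurableT ifr (integrableZl measurableT (f a) ir).
  apply: eq_integrable => // x _ /=.
  by rewrite mulrBl EFinB !EFinM.
apply: (le_trans (le_normr_Rintegral _ _)) => //.
apply: (@le_trans _ _ (\int[mu]_(x in ball a (2 / k)) (k * C * `|f x - f a|))).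
  apply: le_Rintegral => //.
  - exact: integrable_norm iBr.
  - exact: integrableZl iBn.
  - move=> x _; rewrite normrM mulrC ler_wpM2r//.
    by rewrite /rho normrM gtr0_norm// ler_wpM2l// ltW.
rewrite RintegralZl//.
rewrite /davg /iavg lebesgue_measure_ball ?(ltW k20)//.
rewrite fineM//=; last 2 first.
- by rewrite inver ifF//; apply/negbTE; rewrite gt_eqF// mulrn_wgt0.
- exact: integrable_fin_num iBn.
rewrite inver /= ifF; last by apply/negbTE; rewrite gt_eqF// mulrn_wgt0.
rewrite /Rintegral /= mulrA le_eqVlt; apply/orP; left; apply/eqP; congr (_ * _).
by rewrite mulr2n; field; rewrite gt_eqF.
Qed.

Lemma mollify_cvg f a : loc_integrable f -> lebesgue_pt f a ->
  (fun n => \int[mu]_x (f x * rho n.+1%:R a x)) @ \oo --> f a.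
Proof.
move=> lf fa.
have H : (fun n => fine (davg f a (2 / n.+1%:R))) @ \oo --> (0 : R).
  apply: fine_cvg; move: fa; rewrite /lebesgue_pt => /cvge_at_rightP; apply.
  split; first by move=> n; rewrite divr_gt0.
  rewrite -[X in _ --> X](mulr0 2); apply: cvgM; first exact: cvg_cst.
  exact: cvg_harmonic.
apply/cvgrPdist_le => /= e e0.
have eC : 0 < e / (4 * C + 1).
  have C0 : 0 <= C by exact: le_trans (sC 0).
  by rewrite divr_gt0//; lra.
near=> n.
rewrite distrC (le_trans (mollify_le _ lf _))//.
have C0 : 0 <= C by exact: le_trans (sC 0).
have : `|0 - fine (davg f a (2 / n.+1%:R))| <= e / (4 * C + 1).
  near: n; move/cvgrPdist_le : H; exact.
rewrite sub0r normrN ger0_norm; last by rewrite fine_ge0// davg_ge0.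
rewrite ler_pdivlMr; last lra.
rewrite mulrC; apply: le_trans; rewrite ler_wpM2r ?lerDl//.
by rewrite fine_ge0// davg_ge0.
Unshelve. all: by end_near. Qed.

Hypotheses (cS : continuous S) (Sle0 : forall x, x <= 0 -> S x = 0).
Hypotheses (Sge1 : forall x, 1 <= x -> S x = 1) (S01 : forall x, 0 <= S x <= 1).

Lemma step_cvg (a x : R) :
  S (n.+1%:R * x + - (n.+1%:R * a)) @[n --> \oo] --> ((a < x)%R%:R : R).
Proof.
apply: cvg_near_cst; have [ax|xa] := ltP a x; near=> n; rewrite -mulrBr.
  rewrite Sge1// -ler_pdivrMr ?subr_gt0// div1r.
  have : (x - a)^-1 <= n%:R by near: n; exact: nbhs_infty_ger.
  by move/le_trans; apply; rewrite ler_nat.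
by rewrite Sle0// mulr_ge0_le0// subr_le0.
Unshelve. all: by end_near. Qed.

Let phi k a b x := S (k * x + - (k * a)) - S (k * x + - (k * b)).

Let phi_continuous k a b : continuous (phi k a b).
Proof.
have H c : continuous (fun x => S (k * x + - (k * c))).
  move=> x; apply: (@continuous_comp _ _ _ (fun x => k * x + - (k * c)) S); last exact: cS.
  exact: is_derive_continuous (is_derive1_affine _ _ _).
by move=> x; apply: cvgB; exact: H.
Qed.

Let phi_support k a b x : 1 <= k -> a < b -> x \notin `[a, b + 1] -> phi k a b x = 0.
Proof.
move=> k1 ab; rewrite in_itv/= negb_and -!ltNge /phi => /orP[xa|bx].
  by rewrite !Sle0 ?subrr//; nra.
by rewrite !Sge1 ?subrr// -mulrBr -[1]mulr1 ler_pM//; lra.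
Qed.

Lemma step_integral_cvg g a b : loc_integrable g -> a < b ->
  \int[mu]_x (g x * phi n.+1%:R a b x) @[n --> \oo] --> \int[mu]_(x in `[a, b]) g x.
Proof.
move=> [mg gi] ab.
have -> : \int[mu]_(x in `[a, b]) g x = \int[mu]_(x in `[a, b + 1]) (g \_ `]a, b]) x.
  rewrite -Rintegral_itv_obnd_cbnd; last first.
    by apply: integrableS (gi a b) => //; exact: subset_itv_oc_cc.
  rewrite -Rintegral_mkcondr; congr (Rintegral _ _ _).
  rewrite setIidr//; apply: subset_itv; rewrite bnd_simp//; lra.
have -> : (fun n => \int[mu]_x (g x * phi n.+1%:R a b x)) =
   (fun n => fine (\int[mu]_(x in [set` `[a, (b + 1)%R]]) (g x * phi n.+1%:R a b x)%:E)%E).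
  apply/funext => n; rewrite (@Rintegral_support `[a, b + 1])// => x /negP xab.
  by rewrite phi_support ?mulr0// ler1n.
have intg : mu.-integrable `[a, b + 1] (EFin \o (g \_ `]a, b])).
  rewrite -restrict_EFin; apply/integrable_restrict => //.
  by apply: integrableS (gi a (b + 1)) => //; exact: measurableI.
apply: fine_cvg; rewrite /Rintegral fineK; last exact: integrable_fin_num intg.
apply: (@dominated_cvg _ _ _ mu _ _ (fun n x => (g x * phi n.+1%:R a b x)%:E) _
  (fun x => `|g x|%:E)) => //.
- move=> n; apply/measurable_EFinP; apply: measurable_funM; first exact: measurable_funTS.
  by apply: measurable_funTS; exact: continuous_measurable_fun.
- move=> x _; apply: cvg_EFin; first exact: nearW.
  rewrite patchE mem_setE in_itv/=.
  have -> : (if a < x <= b then g x else 0) = g x * ((a < x)%R%:R - (b < x)%R%:R).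
    have [ax|xa] := ltP a x; have [bx|xb] := ltP b x => //=;
      rewrite ?subrr ?subr0 ?mulr0 ?mulr1//; lra.
  by apply: cvgM; [exact: cvg_cst|apply: cvgB; exact: step_cvg].
- exact: integrable_norm (gi a (b + 1)).
- move=> n x _; rewrite lee_fin normrM ler_piMr// /phi ler_norml.
  have := S01 (n.+1%:R * x - n.+1%:R * a); have := S01 (n.+1%:R * x - n.+1%:R * b); lra.
Qed.

End mollifier.

Lemma smooth_step_data : exists (S s : R -> R) (C : R),
  [/\ smooth_expr S, (forall x, is_derive x 1 S (s x)), continuous s,
     (forall x, x \notin `[0, 1] -> s x = 0) & (forall x, `|s x| <= C)] /\
  [/\ (forall x, x <= 0 -> S x = 0), (forall x, 1 <= x -> S x = 1) &
     (forall x, 0 <= S x <= 1)].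
Proof.
have [S [eS S0 S1 S01]] := @exists_smooth_step R.
have [s es dS] := smooth_expr_derive eS.
have [s' _ ds] := smooth_expr_derive es.
have cs : continuous s by move=> x; exact: is_derive_continuous (ds x).
have s0 x : x \notin `[0, 1] -> s x = 0.
  rewrite in_itv/= negb_and -!ltNge => /orP[x0|x1].
    rewrite -(is_derive1E (dS x)); apply: is_derive1E.
    apply: near_is_derive (is_derive_cst (0:R) x 1).
    by near=> y; apply: S0; apply/ltW; near: y; exact: lt_nbhsl.
  rewrite -(is_derive1E (dS x)); apply: is_derive1E.
  apply: near_is_derive (is_derive_cst (1:R) x 1).
  by near=> y; apply: S1; apply/ltW; near: y; exact: lt_nbhsr.
have [M HM] := bounded_itv_continuous 0 1 cs.
exists S, s, M; split; split=> // x.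
have [/HM//|/s0 ->] := boolP (x \in `[0, 1]).
by rewrite normr0; apply: le_trans (HM 0 _); rewrite // in_itv/= lexx ler01.
Unshelve. all: by end_near. Qed.

Lemma weak_derivative_increment f g (a b : R) : loc_integrable f -> loc_integrable g ->
  weak_derivative f g -> lebesgue_pt f a -> lebesgue_pt f b -> a < b ->
  f b - f a = \int[mu]_(x in `[a, b]) g x.
Proof.
move=> lf lg fg fa fb ab.
have [S [s [C [[eS dS cs s0 sC] [S0 S1 S01]]]]] := smooth_step_data.
have S00 : S 0 = 0 by exact: S0.
have S11 : S 1 = 1 by exact: S1.
have cS : continuous S by move=> x; exact: is_derive_continuous (dS x).
have cvl := step_integral_cvg cS S0 S1 S01 lg ab.
have cva := mollify_cvg dS cs s0 sC S00 S11 lf fa.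
have cvb := mollify_cvg dS cs s0 sC S00 S11 lf fb.
apply: oppr_inj; rewrite opprB.
have cvN := cvgN cvl.
have cvab := cvgB cva cvb.
set u := (X in X @ _ --> _) in cvN; set v := (X in X @ _ --> _) in cvab.
suff uv : u = v by rewrite uv in cvN; apply: (cvg_unique _ (cvab _) (cvN _)); exact: Rhausdorff.
apply/funext => n; rewrite /u /v /=.
set k : R := n.+1%:R.
have k1 : 1 <= k by rewrite ler1n.
have k0 : 0 < k by lra.
set phi := (fun x => S (k * x + - (k * a)) - S (k * x + - (k * b))).
have dphi x : is_derive x 1 phi (k * s (k * x + - (k * a)) - k * s (k * x + - (k * b))).
  have H c : is_derive x 1 (fun x => S (k * x + - (k * c))) (k * s (k * x + - (k * c))).
    by rewrite [k * s _]mulrC; exact: (is_derive1_chain (dS _) (is_derive1_affine _ _ _)).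
  exact: is_derive1B.
have tphi : test_function phi.
  apply: (@test_function_itv _ a (b + 1)).
    apply: smooth_expr_derivable.
    have -> : phi = (fun x => S (k * x + - (k * a)) + -1 * S (k * x + - (k * b))).
      by apply/funext => x; rewrite mulN1r.
    apply: smooth_add; first exact: smooth_expr_affine.
    by apply: smooth_mul; [exact: smooth_cst|exact: smooth_expr_affine].
  move=> x; rewrite in_itv/= negb_and -!ltNge /phi => /orP[xa|bx].
    by rewrite !S0 ?subrr//; nra.
  by rewrite !S1 ?subrr//; nra.
have := fg _ tphi; rewrite (_ : (phi^`())%classic =
    fun x => k * s (k * x + - (k * a)) - k * s (k * x + - (k * b))); last first.
  by apply/funext => x; exact: is_derive1E (dphi x).
move=> H; transitivity
  (\int[mu]_x (f x * (k * s (k * x + - (k * a)) - k * s (k * x + - (k * b))))).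
  by rewrite H.
transitivity (\int[mu]_x (f x * (k * s (k * x + - (k * a)))) -
  \int[mu]_x (f x * (k * s (k * x + - (k * b))))); last by [].
have cr c : continuous (fun x => k * s (k * x + - (k * c))) by exact: mollifier_continuous.
have sr c x : x \notin `[c, c + k^-1] -> k * s (k * x + - (k * c)) = 0.
  exact: (mollifier_support s0 k0).
have ir c := integrable_mul_support lf (cr c) (sr c).
by rewrite -(RintegralB _ (ir a) (ir b))//; apply: eq_Rintegral => x _; rewrite mulrBr.
Qed.

Lemma Rintegral_itvD f (a b c : R) : loc_integrable f -> a <= b -> b <= c ->
  \int[mu]_(x in `[a, c]) f x = \int[mu]_(x in `[a, b]) f x + \int[mu]_(x in `[b, c]) f x.
Proof.
move=> [_ fi] ab bc; apply/eqP; rewrite addrC -subr_eq; apply/eqP.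
rewrite Rintegral_itvB ?bnd_simp//.
by rewrite Rintegral_itv_obnd_cbnd//; apply: integrableS (fi b c) => //; exact: subset_itv_oc_cc.
Qed.

Definition primitive f (x0 x : R) : R :=
  if x0 <= x then \int[mu]_(t in `[x0, x]) f t else - \int[mu]_(t in `[x, x0]) f t.

Lemma primitive_increment f x0 x y : loc_integrable f -> x <= y ->
  primitive f x0 y = primitive f x0 x + \int[mu]_(t in `[x, y]) f t.
Proof.
move=> lf xy; rewrite /primitive; have [x0x|xx0] := leP x0 x.
  by rewrite (le_trans x0x xy); exact: Rintegral_itvD.
have [x0y|yx0] := leP x0 y.
  by rewrite (@Rintegral_itvD f x x0 y)// ?(ltW xx0)// addKr.
by rewrite (@Rintegral_itvD f x y x0)// ?(ltW yx0)// opprD addrAC addNr add0r.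
Qed.

Lemma primitive_continuous f x0 : loc_integrable f -> continuous (primitive f x0).
Proof.
move=> lf x.
have xm : x - 1 <= x + 1 by lra.
have := parameterized_integral_continuous xm (lf.2 _ _).
move=> /continuous_within_itvP; rewrite ltrBlDr -addrA ltrDl.
move=> /(_ (addr_gt0 ltr01 ltr01))[/(_ x) + _ _].
rewrite in_itv/= ltrBlDr ltrDl ltr01 => /(_ isT) H.
have {}H := cvgD (cvg_cst (primitive f x0 (x - 1))) H.
rewrite /continuous_at (@primitive_increment f x0 (x - 1) x)//; last lra.
apply: (@cvg_trans _ ((fun y => primitive f x0 (x - 1) +
  \int[mu]_(t in `[x - 1, y]) f t) @ x)); last exact: H.
apply: near_eq_cvg; near=> y.
rewrite (@primitive_increment f x0 (x - 1) y)//.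
apply/ltW; near: y; apply: lt_nbhsr; lra.
Unshelve. all: by end_near. Qed.

Lemma is_derive_primitive f x0 x : loc_integrable f -> continuous f ->
  is_derive x 1 (primitive f x0) (f x).
Proof.
move=> lf cf.
have xx1 : x - 1 < x by lra.
have x1x : x < x + 1 by lra.
have [dF F'] := continuous_FTC1_closed x1x (lf.2 _ _) xx1 (cf x).
rewrite -[f x]add0r.
apply: (@near_is_derive _ _ (fun y => primitive f x0 (x - 1) + \int[mu]_(t in `[x - 1, y]) f t)).
  near=> y; rewrite -primitive_increment//.
  by apply/ltW; near: y; exact: lt_nbhsr.
apply: (is_derive1D (is_derive_cst _ _ _)).
exact: DeriveDef dF (etrans (esym (derive1E _ _)) F').
Unshelve. all: by end_near. Qed.

Lemma ae_exists (P : R -> Prop) : {ae mu, forall x, P x} -> exists x, P x.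
Proof.
move=> [A [mA A0 PA]]; apply: contrapT => nP.
have AT : A = setT by apply/seteqP; split=> // x _; apply: PA => /= Px; apply: nP; exists x.
have : (mu `[0%R, 1%R] <= mu A)%E by apply: le_measure => //; rewrite ?inE// AT.
by rewrite A0 lebesgue_measure_itv/= lte_fin ltr01 -EFinB subr0 lee_fin ler10.
Qed.

Lemma weak_derivative_primitive f g : loc_integrable f -> loc_integrable g ->
  weak_derivative f g ->
  exists x0 c, {ae mu, forall x, f x = c + primitive g x0 x}.
Proof.
move=> lf lg fg.
have aef := lebesgue_differentiation (locally_integrable_of lf).
have [x0 px0] := ae_exists aef; exists x0, (f x0).
apply: filterS aef; first exact: (ae_filter_ringOfSetsType mu).
move=> x px; rewrite /primitive.
have [x0x|xx0] := leP x0 x; last first.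
  by rewrite -(weak_derivative_increment lf lg fg)// opprB addrCA subrr addr0.
move: x0x; rewrite le_eqVlt => /predU1P[<-|x0x].
  by rewrite set_itv1 Rintegral_set1 addr0.
by rewrite -(weak_derivative_increment lf lg fg)// addrCA subrr addr0.
Qed.

Lemma ae_eq_Rintegral (D : set R) f g : measurable D ->
  measurable_fun setT f -> measurable_fun setT g -> {ae mu, forall x, f x = g x} ->
  \int[mu]_(x in D) f x = \int[mu]_(x in D) g x.
Proof.
move=> mD mf mg fg; congr fine; apply: ae_eq_integral => //.
- by apply/measurable_EFinP; exact: measurable_funTS.
- by apply/measurable_EFinP; exact: measurable_funTS.
- apply: filterS fg; first exact: (ae_filter_ringOfSetsType mu).
  by move=> x fgx _ /=; rewrite fgx.
Qed.

Lemma continuous_loc_integrable f : continuous f -> loc_integrable f.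
Proof.
by move=> cf; split=> [|a b]; [exact: continuous_measurable_fun|exact: integrable_itv_continuous].
Qed.

Lemma test_function_derive (phi : R -> R) : test_function phi -> test_function (phi^`())%classic.
Proof.
move=> [dphi cphi]; split; first by move=> n x; rewrite -derive1Sn.
apply: (@subclosed_compact _ _ (closure [set x | phi x != 0])) => //; first exact: closed_closure.
rewrite [X in _ `<=` X](closure_id _).1; last exact: closed_closure.
apply: closure_subset => x /= dx; apply: contrapT => nx; move/eqP: dx; apply.
apply: is_derive1E; apply: near_is_derive (is_derive_cst (0:R) x 1).
have /open_nbhs_nbhs : open_nbhs x (~` closure [set x | phi x != 0]).
  by split=> //; exact/closed_openC/closed_closure.
apply: filterS => y ny; apply/eqP; apply: contrapT => /negP py; apply: ny.
exact: subset_closure.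
Qed.

Lemma test_functionP (phi : R -> R) : test_function phi ->
  continuous phi /\ exists M : R, forall x, x \notin `[- M, M] -> phi x = 0.
Proof.
move=> [dphi cphi]; split.
  move=> x; apply: differentiable_continuous; apply/derivable1_diffP; exact: (dphi 0%N).
have [M [_ MK]] := compact_bounded cphi; exists (M + 1) => x.
rewrite in_itv/= -ler_norml; apply: contraNeq => px; apply: MK; first by rewrite ltrDl.
exact: subset_closure.
Qed.

Lemma is_derive_primitive_ae f (F : R -> R) x0 x : loc_integrable f -> continuous F ->
  {ae mu, forall x, f x = F x} -> is_derive x 1 (primitive f x0) (F x).
Proof.
move=> lf cF fF; have lF := continuous_loc_integrable cF.
suff -> : primitive f x0 = primitive F x0 by exact: is_derive_primitive.
apply/funext => y; rewrite /primitive.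
by case: ifP => _; rewrite (ae_eq_Rintegral _ lf.1 lF.1 fF)//.
Qed.

Lemma Lfun2_Rintegral_sqr_le f g : f \in Lfun mu 2%:E -> g \in Lfun mu 2%:E ->
  exists K : R, forall a b, \int[mu]_(x in `[a, b]) (f x ^+ 2 + g x ^+ 2) <= K.
Proof.
move=> /Lfun2_integrable_sqr if2 /Lfun2_integrable_sqr ig2.
have ifg := integrableD measurableT if2 ig2.
exists (\int[mu]_x (f x ^+ 2 + g x ^+ 2)) => a b.
rewrite Rintegral_mkcond; apply: le_Rintegral => //.
  rewrite -restrict_EFin; apply/integrable_restrict => //.
  by apply: integrableS ifg => //; exact: measurableI.
by move=> x _; rewrite patchE; case: ifP => // _; rewrite addr_ge0 ?sqr_ge0.
Qed.

Lemma regularity (N : nat) (m : 'I_N -> R) (u : 'I_N -> R -> R) :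
  (forall i, H1 (u i)) -> distributional_solution m u ->
  exists w w' : 'I_N -> R -> R,
    [/\ forall i, {ae mu, forall x, u i x = w i x},
        forall i x, is_derive x 1 (w i) (w' i x),
        forall i x, is_derive x 1 (w' i) (- m i * w i x - 2 * (\sum_(j < N) w j x ^+ 2) * w i x) &
        forall i, exists K : R, forall a b,
          \int[mu]_(x in `[a, b]) (w i x ^+ 2 + w' i x ^+ 2) <= K].
Proof.
move=> hu hsol.
have /boolp.choice[g hg] : forall i, exists gi : R -> R,
    gi \in Lfun mu 2%:E /\ weak_derivative (u i) gi.
  by move=> i; have [_ [gi Hgi]] := hu i; exists gi.
have lu i : loc_integrable (u i) by apply: Lfun2_loc_integrable; have [] := hu i.
have lg i : loc_integrable (g i) by apply: Lfun2_loc_integrable; have [] := hg i.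
have /boolp.choice[w hw] : forall i, exists wi : R -> R,
    (exists x0 c, wi = fun x => c + primitive (g i) x0 x) /\ {ae mu, forall x, u i x = wi x}.
  move=> i; have [x0 [c H]] := weak_derivative_primitive (lu i) (lg i) (hg i).2.
  by exists (fun x => c + primitive (g i) x0 x); split=> //; exists x0, c.
have cw i : continuous (w i).
  move=> x; have [[x0 [c ->]] _] := hw i.
  by apply: cvgD; [exact: cvg_cst|exact: primitive_continuous].
have csum : continuous (fun x => \sum_(j < N) w j x ^+ 2).
  apply: continuous_big; first exact: add_continuous.
  by move=> j _ x; exact: (cvgM (cw j x) (cw j x)).
pose h i x : R := - m i * w i x - 2 * (\sum_(j < N) w j x ^+ 2) * w i x.
have ch i : continuous (h i).
  move=> x; apply: cvgB; apply: cvgM; [exact: cvg_cst|exact: cw|apply: cvgM|exact: cw].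
    exact: cvg_cst.
  exact: csum.
have wg i : weak_derivative (g i) (h i).
  move=> phi tphi; have tphi' := test_function_derive tphi.
  have := (hg i).2 _ tphi'; have := hsol i _ tphi.
  rewrite (_ : (phi^`(2))%classic = ((phi^`())^`())%classic)//.
  move=> + E; rewrite E opprK => /eqP; rewrite subr_eq => /eqP ->.
  have [cphi [M HM]] := test_functionP tphi.
  have mphi : measurable_fun setT phi by exact: continuous_measurable_fun.
  have msum : measurable_fun setT (fun x => \sum_(j < N) u j x ^+ 2).
    by apply: measurable_sum => j; apply: measurable_funX; exact: (lu j).1.
  have c1 : continuous (fun x => m i * w i x).
    by move=> x; apply: cvgM; [exact: cvg_cst|exact: cw].
  have c2 : continuous (fun x => 2 * (\sum_(j < N) w j x ^+ 2) * w i x).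
    by move=> x; apply: cvgM; [apply: cvgM; [exact: cvg_cst|exact: csum]|exact: cw].
  have ae1 : \int[mu]_x (m i * u i x * phi x) = \int[mu]_x (m i * w i x * phi x).
    apply: ae_eq_Rintegral => //.
    - apply: measurable_funM => //; apply: measurable_funM => //; exact: (lu i).1.
    - by apply: measurable_funM => //; exact: continuous_measurable_fun.
    - apply: filterS (hw i).2; first exact: (ae_filter_ringOfSetsType mu).
      by move=> x ->.
  have ae2 : \int[mu]_x (2 * (\sum_(j < N) u j x ^+ 2) * u i x * phi x) =
      \int[mu]_x (2 * (\sum_(j < N) w j x ^+ 2) * w i x * phi x).
    apply: ae_eq_Rintegral => //.
    - apply: measurable_funM => //; apply: measurable_funM; last exact: (lu i).1.
      exact: measurable_funM.
    - by apply: measurable_funM => //; exact: continuous_measurable_fun.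
    - have aeall : {ae mu, forall x, forall j, u j x = w j x}.
        by apply: filter_forall => j; exact: (hw j).2.
      apply: filterS aeall; first exact: (ae_filter_ringOfSetsType mu).
      by move=> x ux; rewrite ux; under eq_bigr do rewrite ux.
  have i1 := integrable_mul_support (continuous_loc_integrable c1) cphi HM.
  have i2 := integrable_mul_support (continuous_loc_integrable c2) cphi HM.
  have ih := integrable_mul_support (continuous_loc_integrable (ch i)) cphi HM.
  have : \int[mu]_x (h i x * phi x) + (\int[mu]_x (m i * w i x * phi x) +
      \int[mu]_x (2 * (\sum_(j < N) w j x ^+ 2) * w i x * phi x)) = 0.
    rewrite -(RintegralD _ i1 i2)// -(RintegralD _ ih (integrableD _ i1 i2))//.
    transitivity (\int[mu]_x (0 : R)); last by rewrite /Rintegral integral0.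
    by apply: eq_Rintegral => x _; rewrite /h; ring.
  rewrite ae1 ae2 => /eqP; rewrite addr_eq0 => /eqP ->.
  by rewrite opprK.
have /boolp.choice[w' hw'] : forall i, exists wi' : R -> R,
    (exists x0 c, wi' = fun x => c + primitive (h i) x0 x) /\ {ae mu, forall x, g i x = wi' x}.
  move=> i.
  have [x0 [c H]] := weak_derivative_primitive (lg i) (continuous_loc_integrable (ch i)) (wg i).
  by exists (fun x => c + primitive (h i) x0 x); split=> //; exists x0, c.
have dw' i x : is_derive x 1 (w' i) (h i x).
  have [[x0 [c ->]] _] := hw' i; rewrite -[h i x]add0r.
  apply: (is_derive1D (is_derive_cst _ _ _)); apply: is_derive_primitive => //.
  exact: continuous_loc_integrable.
have cw' i : continuous (w' i) by move=> x; exact: is_derive_continuous (dw' i x).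
exists w, w'; split=> //.
- by move=> i; have [] := hw i.
- move=> i x; have [[x0 [c ->]] _] := hw i; rewrite -[w' i x]add0r.
  apply: (is_derive1D (is_derive_cst _ _ _)); apply: is_derive_primitive_ae => //.
  by have [] := hw' i.
- move=> i; have [K HK] := Lfun2_Rintegral_sqr_le (hu i).1 (hg i).1; exists K => a b.
  apply: le_trans (HK a b); rewrite le_eqVlt; apply/orP; left; apply/eqP.
  have msq f f' : measurable_fun setT f -> measurable_fun setT f' ->
      measurable_fun setT (fun x => f x ^+ 2 + f' x ^+ 2).
    by move=> mf mf'; apply: measurable_funD; exact: measurable_funX.
  apply: ae_eq_Rintegral => //.
  + by apply: msq; exact: continuous_measurable_fun.
  + by apply: msq; [exact: (lu i).1|exact: (lg i).1].
  + apply: filterS2 (hw i).2 (hw' i).2; first exact: (ae_filter_ringOfSetsType mu).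
    by move=> x -> ->.
Qed.
End weak.

(** * Differential inequalities at minus infinity *)

Section ode.
Context {R : realType}.
Implicit Types (f g : R -> R) (x y X : R).

Lemma eq_cvg_fun (F : set_system R) f g (l : R) :
  f x @[x --> F] --> l -> f =1 g -> g x @[x --> F] --> l.
Proof. by move=> fl /funext <-. Qed.

Lemma nondecreasing_derive f f' X : (forall x, is_derive x 1 f (f' x)) ->
  (forall x, x <= X -> 0 <= f' x) -> forall x y, x <= y -> y <= X -> f x <= f y.
Proof.
move=> df f'0; apply: ger0_derive1_ndecrNy.
- by move=> x _; have [] := df x.
- by move=> x; rewrite in_itv/= => xX; rewrite (is_derive1E (df x)) f'0// ltW.
- by apply: continuous_subspaceT => x; exact: is_derive_continuous (df x).
Qed.

Lemma nonincreasing_derive f f' X : (forall x, is_derive x 1 f (f' x)) ->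
  (forall x, x <= X -> f' x <= 0) -> forall x y, x <= y -> y <= X -> f y <= f x.
Proof.
move=> df f'0 x y xy yX; rewrite -lerN2.
apply: (@nondecreasing_derive (fun x => - f x) (fun x => - f' x) X) => // z.
by move=> zX; rewrite oppr_ge0 f'0.
Qed.

Lemma derive_ge0_limit_le f f' l X : (forall x, is_derive x 1 f (f' x)) ->
  (forall x, x <= X -> 0 <= f' x) -> f x @[x --> -oo] --> l -> forall y, y <= X -> l <= f y.
Proof.
move=> df f'0 fl y yX; rewrite -(cvg_lim (@Rhausdorff R) fl).
apply: limr_le; first by apply/cvg_ex; exists l.
near=> x.
apply: (nondecreasing_derive df f'0) => //.
Unshelve. all: by end_near. Qed.

Lemma derive_le0_limit_ge f f' l X : (forall x, is_derive x 1 f (f' x)) ->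
  (forall x, x <= X -> f' x <= 0) -> f x @[x --> -oo] --> l -> forall y, y <= X -> f y <= l.
Proof.
move=> df f'0 fl y yX; rewrite -lerN2.
apply: (@derive_ge0_limit_le (fun x => - f x) (fun x => - f' x) _ X) => //.
- by move=> x xX; rewrite oppr_ge0 f'0.
- exact: cvgN.
Qed.

Lemma derive_ge0_is_cvg f f' m X : (forall x, is_derive x 1 f (f' x)) ->
  (forall x, x <= X -> 0 <= f' x) -> (forall x, x <= X -> m <= f x) ->
  exists l : R, f x @[x --> -oo] --> l.
Proof.
move=> df f'0 mf.
have nd := nondecreasing_derive df f'0.
pose A := [set f x | x in [set x | x <= X]].
have Ainf : has_inf A.
  by split; [exists (f X), X => //=|exists m => _ [x xX <-]; exact: mf].
exists (inf A); apply/cvgrPdist_le => e e0.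
have [_ [z zX <-] fz] := inf_adherent e0 Ainf.
near=> x.
have xz : x <= z by near: x; apply: nbhs_ninfty_le; rewrite num_real.
have xX : x <= X by exact: le_trans xz zX.
have ix : inf A <= f x by apply: ge_inf; [exact: Ainf.2|exists x].
rewrite ler_norml; have := nd _ _ xz zX; lra.
Unshelve. all: by end_near. Qed.

Lemma expR_cvgNy (k : R) : 0 < k -> expR (k * x) @[x --> -oo] --> (0 : R).
Proof.
move=> k0; apply/cvgrPdist_le => e e0; near=> x.
rewrite sub0r normrN ger0_norm ?expR_ge0// -[e]lnK ?posrE// ler_expR.
rewrite mulrC -ler_pdivlMr//; near: x; apply: nbhs_ninfty_le; rewrite num_real//.
Unshelve. all: by end_near. Qed.

(* [E' <= C E] gives [E x <= expR C * E xi] for [xi] in [[x - 1, x]]; choose [xi] by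
   the mean value theorem so that [E xi = P x - P (x - 1)], which tends to 0. *)
Lemma decay_of_integrable (E E' P : R -> R) (C K : R) :
  (forall x, is_derive x 1 P (E x)) -> (forall x, is_derive x 1 E (E' x)) ->
  (forall x, 0 <= E x) -> 0 <= C -> (forall x, x <= 0 -> E' x <= C * E x) ->
  (forall x, x <= 0 -> K <= P x) -> E x @[x --> -oo] --> (0 : R).
Proof.
move=> dP dE E0 C0 E'C KP.
have [l Pl] := derive_ge0_is_cvg dP (fun x _ => E0 x) KP.
have Pl1 : P (x - 1) @[x --> -oo] --> l.
  apply: (cvg_comp (fun x => x - 1) P) Pl.
  exact: cvg_addrr_Ny.
have PP : expR C * (P x - P (x - 1)) @[x --> -oo] --> (0 : R).
  rewrite -(mulr0 (expR C)) -[X in _ * X](subrr l).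
  by apply: cvgM; [exact: cvg_cst|exact: cvgB].
apply: (squeeze_cvgr _ (cvg_cst 0) PP); near=> x.
rewrite E0/=.
have x0 : x <= 0 by near: x; apply: nbhs_ninfty_le; rewrite num_real.
have [xi] := @MVT_segment _ P E (x - 1) x (ltac:(lra)) (fun y _ => dP y)
   (continuous_subspaceT (fun y => is_derive_continuous (dP y))).
rewrite in_itv/= => /andP[xi1 xi2] ->; rewrite opprB addrC subrK mulr1.
pose h y := E y * expR (- C * y).
have dh y : is_derive y 1 h (E' y * expR (- C * y) + E y * (- C * expR (- C * y))).
  exact: (is_derive1M (dE y) (is_derive1_exp y (- C))).
have := @nonincreasing_derive h _ 0 dh _ _ _ xi2 x0.
have H y : y <= 0 -> E' y * expR (- C * y) + E y * (- C * expR (- C * y)) <= 0.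
  move=> y0; have := E'C _ y0; have := expR_gt0 (- C * y); set e := expR _ => e0 H.
  rewrite mulrA -mulrDl pmulr_lle0//; lra.
move=> /(_ H); rewrite /h mulNr expRN ler_pdivrMr ?expR_gt0// => /le_trans; apply.
rewrite -mulrA -expRD mulrC ler_wpM2r// ler_expR; nra.
Unshelve. all: by end_near. Qed.

Lemma vanishing_of_gronwall (L L' : R -> R) (K d X : R) : 0 < d -> 
  (forall x, is_derive x 1 L (L' x)) -> (forall x, 0 <= L x) ->
  (forall x, x <= X -> L' x <= K * expR (d * x) * L x) ->
  L x @[x --> -oo] --> (0 : R) -> forall x, x <= X -> L x = 0.
Proof.
move=> d0 dL L0 L'K Ll.
pose q (x : R) := - (K / d) * expR (d * x).
have dq x : is_derive x 1 q (- (K / d) * (d * expR (d * x))).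
  exact: (is_derive1Z _ (is_derive1_exp x d)).
have deq x : is_derive x 1 (fun x => expR (q x)) (expR (q x) * (- (K / d) * (d * expR (d * x)))).
  exact: is_derive1_chain (is_derive_expR _) (dq x).
have dh x := is_derive1M (dL x) (deq x).
have q0 : expR (q x) @[x --> -oo] --> (1 : R).
  rewrite -expR0 -(mulr0 (- (K / d))); apply: continuous_cvg; first exact: continuous_expR.
  by apply: cvgM; [exact: cvg_cst|exact: expR_cvgNy].
have hl : L x * expR (q x) @[x --> -oo] --> (0 : R).
  by rewrite -(mul0r 1); apply: cvgM.
have H x : x <= X -> L' x * expR (q x) + L x * (expR (q x) * (- (K / d) * (d * expR (d * x)))) <= 0.
  move=> xX; have := L'K _ xX; have := expR_gt0 (q x); set e := expR (q x); set ed := expR (d * x).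
  move=> e0 H; rewrite (_ : _ + _ = e * (L' x - K * ed * L x)); last by field; rewrite gt_eqF.
  by rewrite pmulr_rle0//; lra.
move=> x xX; apply/eqP; rewrite eq_le L0 andbT.
have := derive_le0_limit_ge dh H hl xX.
by rewrite pmulr_lle0 ?expR_gt0.
Qed.

Section single_equation.
Variables (w w' V : R -> R) (eta : R).
Hypotheses (eta0 : 0 < eta) (dw : forall x, is_derive x 1 w (w' x)).
Hypothesis dw' : forall x, is_derive x 1 w' ((eta ^+ 2 - V x) * w x).
Hypothesis V0 : forall x, 0 <= V x.
Hypotheses (wl : w x @[x --> -oo] --> (0 : R)) (w'l : w' x @[x --> -oo] --> (0 : R)).

Lemma decaying_ww'_ge0 X : (forall x, x <= X -> V x <= eta ^+ 2 / 2) ->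
  forall x, x <= X -> 0 <= w x * w' x.
Proof.
move=> VX; apply: (derive_ge0_limit_le (fun x => is_derive1M (dw x) (dw' x))).
  move=> x xX; have := VX x xX; have := sqr_ge0 (w' x); have := sqr_ge0 (w x); nra.
by rewrite -(mul0r 0); exact: cvgM.
Qed.

Lemma decaying_sqr_le X : (forall x, x <= X -> V x <= eta ^+ 2 / 2) ->
  exists C, forall x, x <= X -> w x ^+ 2 <= C * expR (eta * x).
Proof.
move=> VX; have ww' := decaying_ww'_ge0 VX.
pose G x := w' x + eta * w x.
have dG x : is_derive x 1 G ((eta ^+ 2 - V x) * w x + eta * w' x).
  by apply: is_derive1D => //; exact: is_derive1Z.
have dh x := is_derive1M (is_derive1X 2 (dG x)) (is_derive1_exp x (- eta)).
have mono := nondecreasing_derive dh _.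
exists (G X ^+ 2 * expR (- eta * X) / eta ^+ 2) => x xX.
have H y : y <= X -> 0 <= 2%:R * G y ^+ 2.-1 * ((eta ^+ 2 - V y) * w y + eta * w' y) *
     expR (- eta * y) + G y ^+ 2 * (- eta * expR (- eta * y)).
  move=> yX; have := ww' y yX; have := VX y yX; have := expR_gt0 (- eta * y).
  set e := expR _ => e0 VyX wwy; rewrite /= expr1.
  rewrite (_ : _ + _ = e * (eta * G y ^+ 2 - 2 * V y * (w y * G y))); last by rewrite /G; ring.
  rewrite pmulr_rge0// subr_ge0.
  have wG : 0 <= w y * G y.
    rewrite /G mulrDr mulrCA -expr2 addr_ge0// mulr_ge0 ?sqr_ge0//; exact: ltW.
  have GG : eta * (w y * G y) <= G y ^+ 2.
    rewrite -subr_ge0 (_ : _ - _ = w' y ^+ 2 + eta * (w y * w' y)); last by rewrite /G; ring.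
    by rewrite addr_ge0 ?sqr_ge0// mulr_ge0 ?(ltW eta0).
  apply: le_trans (_ : eta ^+ 2 * (w y * G y) <= _); first by rewrite ler_wpM2r//; lra.
  by rewrite expr2 -mulrA ler_wpM2l// ltW.
have := mono X H x X xX (lexx X); rewrite mulNr expRN ler_pdivrMr ?expR_gt0//.
move=> H2; rewrite mulrAC ler_pdivlMr ?exprn_gt0//.
apply: le_trans H2; rewrite -subr_ge0.
rewrite (_ : _ - _ = w' x ^+ 2 + 2 * eta * (w x * w' x)); last by rewrite /G; ring.
by rewrite addr_ge0 ?sqr_ge0// mulr_ge0 ?ww'// mulr_ge0 ?(ltW eta0).
Qed.

(* As [0 <= w w'], the growing mode [w' + eta w] controls both [w] and the other
   mode [w' - eta w]; hence [expR (- eta x) * (w' + eta w)] has a derivative at most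
   a multiple of [expR (d * x)] times itself, and its limit is 0 only if [w = 0]. *)
Lemma decaying_asymptotics (K d X : R) : 0 < d -> 0 <= K ->
  (forall x, x <= X -> V x <= K * expR (d * x)) -> (forall x, x <= X -> 0 <= w x * w' x) ->
  exists c, [/\ expR (- eta * x) * w x @[x --> -oo] --> c,
     expR (- eta * x) * w' x @[x --> -oo] --> (eta * c : R) &
     c = 0 -> forall x, x <= X -> w x = 0 /\ w' x = 0].
Proof.
move=> d0 K0 VX ww'.
pose G x := w' x + eta * w x.
have dG x : is_derive x 1 G ((eta ^+ 2 - V x) * w x + eta * w' x).
  by apply: is_derive1D => //; exact: is_derive1Z.
have wG x : x <= X -> 0 <= w x * G x.
  move=> xX; rewrite /G mulrDr mulrCA -expr2 addr_ge0 ?ww'//.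
  by rewrite mulr_ge0 ?sqr_ge0// ltW.
have GG x : x <= X -> w' x ^+ 2 + (eta * w x) ^+ 2 <= G x ^+ 2.
  move=> xX; rewrite -subr_ge0.
  rewrite (_ : _ - _ = 2 * eta * (w x * w' x)); last by rewrite /G; ring.
  by rewrite mulr_ge0 ?ww'// mulr_ge0 ?(ltW eta0).
have wleG x : x <= X -> `|w x| <= `|G x| / eta.
  move=> xX; rewrite ler_pdivlMr// -{1}(gtr0_norm eta0) -normrM mulrC.
  rewrite -ler_sqr ?nnegrE// !real_normK ?num_real//.
  by have := GG x xX; have := sqr_ge0 (w' x); lra.
pose p x := expR (- eta * x) * G x.
have dp x : is_derive x 1 p (- (expR (- eta * x) * V x * w x)).
  apply: is_derive_eq (is_derive1M (is_derive1_exp x (- eta)) (dG x)) _.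
  by rewrite /G; ring.
have p'le x : x <= X -> `|expR (- eta * x) * V x * w x| <= K / eta * expR (d * x) * `|p x|.
  move=> xX; rewrite /p !normrM !(ger0_norm (expR_ge0 _)) (ger0_norm (V0 x)).
  have := VX x xX; have := wleG x xX; have := expR_ge0 (- eta * x).
  set e := expR (- _ * _); set ed := expR _ => e0 wx Vx.
  rewrite -mulrA (_ : K / eta * ed * (e * `|G x|) = e * (K * ed * (`|G x| / eta))).
    by rewrite ler_wpM2l// ler_pM.
  by field; rewrite gt_eqF.
have [B [B0 pB]] : exists B : R, 0 <= B /\ forall x, x <= X -> `|p x| <= B.
  pose q (x : R) := 2 * K / eta / d * expR (d * x).
  have dq x : is_derive x 1 q (2 * K / eta / d * (d * expR (d * x))).
    exact: (is_derive1Z _ (is_derive1_exp x d)).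
  have deq x := is_derive1_chain (is_derive_expR _) (dq x).
  have dh x := is_derive1M (is_derive1X 2 (dp x)) (deq x).
  have mono := nondecreasing_derive dh _.
  exists (Num.sqrt (p X ^+ 2 * expR (q X))); split=> // x xX.
  rewrite -sqrtr_sqr ler_sqrt; last by rewrite mulr_ge0 ?sqr_ge0 ?expR_ge0.
  apply: le_trans (mono X _ x X xX (lexx _)).
    rewrite ler_peMr ?sqr_ge0// -expR0 ler_expR /q.
    by rewrite mulr_ge0 ?expR_ge0// !mulr_ge0 ?invr_ge0 ?(ltW eta0) ?(ltW d0).
  move=> y yX; rewrite /= expr1.
  have := p'le y yX; set t := expR _ * V y * w y => tp.
  rewrite (_ : _ + _ = expR (q y) * 2 * (K / eta * expR (d * y) * p y ^+ 2 - p y * t)); last first.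
    by field; rewrite !gt_eqF.
  rewrite pmulr_rge0 ?mulr_gt0 ?expR_gt0// subr_ge0 (le_trans (ler_norm _))//.
  rewrite normrM -[p y ^+ 2]real_normK ?num_real// expr2 [leRHS]mulrA [leRHS]mulrC.
  by rewrite ler_wpM2l.
pose k := K / eta * B.
have p'le2 x : x <= X -> `|expR (- eta * x) * V x * w x| <= k * expR (d * x).
  move=> xX; apply: le_trans (p'le x xX) _; rewrite /k mulrAC ler_wpM2r ?expR_ge0//.
  by rewrite ler_wpM2l ?pB// mulr_ge0// invr_ge0 ltW.
have kd : k / d * expR (d * x) @[x --> -oo] --> (0 : R).
  by rewrite -(mulr0 (k / d)); apply: cvgM; [exact: cvg_cst|exact: expR_cvgNy].
have [l pl] : exists l : R, p x @[x --> -oo] --> l.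
  have dr x := is_derive1D (dp x) (is_derive1Z (k / d) (is_derive1_exp x d)).
  have [||l rl] := @derive_ge0_is_cvg _ _ (- B) X dr.
  - move=> x xX; have := p'le2 x xX; rewrite ler_norml => /andP[_].
    by rewrite (mulrA (k / d)) divfK ?gt_eqF//; lra.
  - move=> x xX; have := pB x xX; rewrite ler_norml => /andP[pB1 _].
    rewrite -[- B]addr0 lerD// mulr_ge0 ?expR_ge0// divr_ge0 ?(ltW d0)//.
    by rewrite /k !mulr_ge0// invr_ge0 (ltW eta0).
  exists l; rewrite -(subr0 l).
  by apply: eq_cvg_fun (cvgB rl kd) _ => x; rewrite /= addrK.
pose H x := w' x - eta * w x.
have Hl : expR (- eta * x) * H x @[x --> -oo] --> (0 : R).
  pose y x := expR (eta * x) * H x.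
  have dH x : is_derive x 1 H ((eta ^+ 2 - V x) * w x - eta * w' x).
    by apply: is_derive1B => //; exact: is_derive1Z.
  have dy x : is_derive x 1 y (- (expR (eta * x) * V x * w x)).
    apply: is_derive_eq (is_derive1M (is_derive1_exp x eta) (dH x)) _.
    by rewrite /H; ring.
  have e2 x : expR (eta * x) = expR (2 * eta * x) * expR (- eta * x).
    by rewrite -expRD; congr expR; ring.
  pose n := 2 * eta + d.
  have n0 : 0 < n by rewrite addr_gt0// mulr_gt0.
  have en x : expR (n * x) = expR (2 * eta * x) * expR (d * x).
    by rewrite -expRD -mulrDl.
  have y'le x : x <= X -> `|expR (eta * x) * V x * w x| <= k * expR (n * x).
    move=> xX; rewrite (_ : expR (eta * x) * V x * w x =
      expR (2 * eta * x) * (expR (- eta * x) * V x * w x)); last by rewrite e2 !mulrA.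
    rewrite normrM ger0_norm ?expR_ge0//.
    have -> : k * expR (n * x) = expR (2 * eta * x) * (k * expR (d * x)).
      by rewrite en mulrCA.
    by rewrite ler_wpM2l ?expR_ge0// p'le2.
  have yl : y x @[x --> -oo] --> (0 : R).
    have H0 : H x @[x --> -oo] --> (0 - eta * 0 : R).
      by apply: cvgB => //; apply: cvgM => //; exact: cvg_cst.
    rewrite -(mul0r (0 - eta * 0)); apply: cvgM => //; exact: expR_cvgNy.
  have kn : k / n * expR (n * x) @[x --> -oo] --> (0 : R).
    by rewrite -(mulr0 (k / n)); apply: cvgM; [exact: cvg_cst|exact: expR_cvgNy].
  have yle x : x <= X -> `|y x| <= k / n * expR (n * x).
    move=> xX; rewrite ler_norml.
    have d1 z := is_derive1D (dy z) (is_derive1Z (k / n) (is_derive1_exp z n)).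
    have d2 z := is_derive1B (dy z) (is_derive1Z (k / n) (is_derive1_exp z n)).
    have s1 z : z <= X -> 0 <= - (expR (eta * z) * V z * w z) + k / n * (n * expR (n * z)).
      move=> zX; have := y'le z zX; rewrite ler_norml => /andP[_].
      by rewrite (mulrA (k / n)) divfK ?gt_eqF//; lra.
    have s2 z : z <= X -> - (expR (eta * z) * V z * w z) - k / n * (n * expR (n * z)) <= 0.
      move=> zX; have := y'le z zX; rewrite ler_norml => /andP[+ _].
      by rewrite (mulrA (k / n)) divfK ?gt_eqF//; lra.
    have l1 : y z + k / n * expR (n * z) @[z --> -oo] --> (0 : R).
      by rewrite -(addr0 0); apply: cvgD.
    have l2 : y z - k / n * expR (n * z) @[z --> -oo] --> (0 : R).
      by rewrite -(subr0 0); apply: cvgB.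
    have h1 := derive_ge0_limit_le d1 s1 l1 xX.
    have h2 := derive_le0_limit_ge d2 s2 l2 xX.
    by apply/andP; split; [rewrite -subr_ge0 opprK|rewrite -subr_le0].
  have kd' : - (k / n * expR (d * x)) @[x --> -oo] --> (0 : R).
    rewrite -oppr0 -(mulr0 (k / n)); apply: cvgN.
    by apply: cvgM; [exact: cvg_cst|exact: expR_cvgNy].
  have kd'' : k / n * expR (d * x) @[x --> -oo] --> (0 : R).
    by rewrite -(mulr0 (k / n)); apply: cvgM; [exact: cvg_cst|exact: expR_cvgNy].
  apply: (squeeze_cvgr _ kd' kd''); near=> x; rewrite -ler_norml.
  have xX : x <= X by near: x; apply: nbhs_ninfty_le; rewrite num_real.
  have := yle x xX; rewrite /y e2 -mulrA normrM ger0_norm ?expR_ge0// => yx.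
  rewrite -(ler_pM2l (expR_gt0 (2 * eta * x))); apply: le_trans yx _.
  by rewrite en [leRHS]mulrCA.
exists (l / (2 * eta)); split.
- have pH : p x - expR (- eta * x) * H x @[x --> -oo] --> (l - 0 : R) by apply: cvgB.
  rewrite -[l]subr0; apply: eq_cvg_fun (cvgM pH (cvg_cst (2 * eta)^-1)) _ => x.
  by rewrite /= /p /G /H; field; rewrite gt_eqF.
- rewrite (_ : eta * (l / (2 * eta)) = (l + 0) / 2); last by field; rewrite gt_eqF.
  have pH : p x + expR (- eta * x) * H x @[x --> -oo] --> (l + 0 : R) by apply: cvgD.
  apply: eq_cvg_fun (cvgM pH (cvg_cst (2^-1 : R))) _ => x.
  by rewrite /= /p /G /H; field.
- move=> /eqP; rewrite mulf_eq0 invr_eq0 mulf_eq0 pnatr_eq0 (gt_eqF eta0)/= orbF => /eqP l0.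
  have p20 : p x ^+ 2 @[x --> -oo] --> (0 : R).
    by rewrite -(mulr0 0) -{1}l0 -{1}l0; exact: cvgM.
  have pp x : x <= X -> p x ^+ 2 <= 0.
    apply: (derive_le0_limit_ge (fun x => is_derive1X 2 (dp x)) _ p20).
    move=> y yX; rewrite /= expr1 mulrN oppr_le0 /p.
    have := wG y yX; set a := expR _; move: (G y) => Gy wGy.
    rewrite (_ : 2 * (a * Gy) * (a * V y * w y) = 2 * a ^+ 2 * V y * (w y * Gy)); last by ring.
    by rewrite mulr_ge0// mulr_ge0// mulr_ge0// sqr_ge0.
  move=> x xX; have G0 : G x = 0.
    have := pp x xX; rewrite /p exprMn pmulr_rle0 ?exprn_gt0 ?expR_gt0// => G2.
    by apply/eqP; rewrite -sqrf_eq0 eq_le G2 sqr_ge0.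
  have := GG x xX; rewrite G0 expr0n/= => H2.
  have w20 : w x ^+ 2 = 0.
    have := sqr_ge0 (w x); have := sqr_ge0 (w' x).
    by have : 0 < eta ^+ 2 := exprn_gt0 2 eta0; nra.
  have w0 : w x = 0 by apply/eqP; rewrite -sqrf_eq0 w20.
  by split=> //; move: G0; rewrite /G w0 mulr0 addr0.
Unshelve. all: by end_near. Qed.

End single_equation.

Lemma sqr_sum_le (n : nat) (t : 'I_n -> R) :
  (\sum_i t i) ^+ 2 <= n%:R * \sum_i t i ^+ 2.
Proof.
rewrite expr2 big_distrlr /=.
apply: (@le_trans _ _ (\sum_i \sum_j (t i ^+ 2 / 2 + t j ^+ 2 / 2))).
  apply: ler_sum => i _; apply: ler_sum => j _.
  by have := sqr_ge0 (t i - t j); lra.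
rewrite (eq_bigr (fun i => n%:R * (t i ^+ 2 / 2) + (\sum_j t j ^+ 2) / 2)); last first.
  by move=> i _; rewrite big_split /= sumr_const card_ord mulr_natl mulr_suml.
rewrite big_split /= sumr_const card_ord -mulr_sumr -mulr_suml -mulr_natl; lra.
Qed.

Lemma linear_system_vanishing (n : nat) (A B f : 'I_n -> R -> R) (k : 'I_n -> R) (D d X : R) :
  0 < d -> 0 <= D -> (forall i, 0 <= k i) ->
  (forall i x, is_derive x 1 (A i) (f i x)) ->
  (forall i x, is_derive x 1 (B i) (- k i * B i x + f i x)) ->
  (forall i x, x <= X -> `|f i x| <= D * expR (d * x) * \sum_j (`|A j x| + `|B j x|)) ->
  (forall i, A i x @[x --> -oo] --> (0 : R)) -> (forall i, B i x @[x --> -oo] --> (0 : R)) ->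
  forall i x, x <= X -> A i x = 0 /\ B i x = 0.
Proof.
move=> d0 D0 k0 dA dB fle Al Bl.
pose L x := \sum_i (A i x ^+ 2 + B i x ^+ 2).
have dL x : is_derive x 1 L (\sum_i (2%:R * A i x ^+ 1 * f i x +
    2%:R * B i x ^+ 1 * (- k i * B i x + f i x))).
  apply: is_derive1_sum => i.
  exact: (is_derive1D (is_derive1X 2 (dA i x)) (is_derive1X 2 (dB i x))).
have L0 x : 0 <= L x by apply: sumr_ge0 => i _; rewrite addr_ge0 ?sqr_ge0.
have Ll : L x @[x --> -oo] --> (0 : R).
  rewrite -[X in _ --> X](_ : \sum_(i < n) (0 * 0 + 0 * 0) = 0); last first.
    by rewrite big1// => i _; rewrite mul0r addr0.
  apply: cvg_big; first exact: add_continuous.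
  by move=> i _; apply: cvgD; exact: cvgM.
have LK x : x <= X -> \sum_i (2%:R * A i x ^+ 1 * f i x +
    2%:R * B i x ^+ 1 * (- k i * B i x + f i x)) <= 4 * D * n%:R * expR (d * x) * L x.
  move=> xX; pose t i := `|A i x| + `|B i x|.
  have t0 i : 0 <= t i by rewrite addr_ge0.
  apply: (@le_trans _ _ (\sum_i 2 * (t i * (D * expR (d * x) * \sum_j t j)))).
    apply: ler_sum => i _; rewrite !expr1.
    have := fle i x xX; rewrite -/(t _) => /(ler_wpM2l (t0 i)) H.
    have : A i x * f i x + B i x * f i x <= t i * `|f i x|.
      by rewrite -mulrDl (le_trans (ler_norm _))// normrM ler_wpM2r// ler_normD.
    have := mulr_ge0 (k0 i) (sqr_ge0 (B i x)).
    rewrite /t in H *; nra.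
  rewrite -mulr_sumr -mulr_suml.
  have := sqr_sum_le t; have : \sum_i t i ^+ 2 <= 2 * L x.
    rewrite /L mulr_sumr; apply: ler_sum => i _.
    rewrite -[A i x ^+ 2]real_normK ?num_real// -[B i x ^+ 2]real_normK ?num_real// /t.
    by have := sqr_ge0 (`|A i x| - `|B i x|); nra.
  set T := \sum_i t i; set T2 := \sum_i _ => h1 h2.
  have h3 : T ^+ 2 <= n%:R * (2 * L x) by rewrite (le_trans h2)// ler_wpM2l.
  have De : 0 <= 2 * (D * expR (d * x)) by rewrite !mulr_ge0 ?expR_ge0.
  have := ler_wpM2l De h3.
  rewrite (_ : 2 * (D * expR (d * x)) * T ^+ 2 = 2 * (T * (D * expR (d * x) * T))); last by ring.
  by move/le_trans; apply; rewrite le_eqVlt; apply/orP; left; apply/eqP; ring.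
move=> i x xX.
have /eqP := vanishing_of_gronwall d0 dL L0 LK Ll xX.
rewrite psumr_eq0; last by move=> j _; rewrite addr_ge0 ?sqr_ge0.
move/allP/(_ i (mem_index_enum i)); rewrite paddr_eq0 ?sqr_ge0// !sqrf_eq0.
by move=> /andP[/eqP ? /eqP ?].
Qed.

Lemma second_order_unique (w w' q : R -> R) (X : R) :
  (forall x, is_derive x 1 w (w' x)) -> (forall x, is_derive x 1 w' (q x * w x)) ->
  continuous q -> w X = 0 -> w' X = 0 -> forall x, X <= x -> w x = 0.
Proof.
move=> dw dw' cq wX w'X Y XY.
have [M [_ HM]] : bounded_set (q @` `[X, Y]).
  apply: compact_bounded; apply: continuous_compact; last exact: segment_compact.
  exact: continuous_subspaceT.
pose C := 2 + `|M|.
pose h x := (w x ^+ 2 + w' x ^+ 2) * expR (- C * x).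
have dh x := is_derive1M (is_derive1D (is_derive1X 2 (dw x)) (is_derive1X 2 (dw' x)))
   (is_derive1_exp x (- C)).
have hY : h Y <= h X.
  apply: (@ler0_derive1_nincr _ h X Y) => //.
  - move=> x; rewrite in_itv/= => /andP[Xx xY]; rewrite (is_derive1E (dh x)) /= !expr1.
    have qM : `|q x| <= `|M| + 1.
      apply: HM; first by rewrite (le_lt_trans (ler_norm M))// ltrDl.
      by exists x => //=; rewrite in_itv/= !ltW.
    rewrite (_ : _ + _ = expR (- C * x) *
      (2 * (1 + q x) * (w x * w' x) - C * (w x ^+ 2 + w' x ^+ 2))); last by ring.
    rewrite pmulr_rle0 ?expR_gt0// subr_le0.
    have : `|1 + q x| <= C.
      by rewrite (le_trans (ler_normD _ _))// normr1 /C; lra.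
    rewrite ler_norml => /andP[z1 z2].
    have p1 : 0 <= (C - (1 + q x)) * (w x + w' x) ^+ 2 by rewrite mulr_ge0 ?sqr_ge0// subr_ge0.
    have p2 : 0 <= (C + (1 + q x)) * (w x - w' x) ^+ 2 by rewrite mulr_ge0 ?sqr_ge0//; lra.
    lra.
  - by apply: continuous_subspaceT => x; exact: is_derive_continuous (dh x).
move: hY; rewrite /h wX w'X expr0n/= addr0 mul0r pmulr_lle0 ?expR_gt0// => w2.
by apply/eqP; rewrite -sqrf_eq0 eq_le sqr_ge0 andbT (le_trans _ w2)// lerDl sqr_ge0.
Qed.
End ode.

(** * Cauchy-like matrices *)

Lemma det_1B_rank1 (F : comNzRingType) (n : nat) (v : 'cV[F]_n) (s : 'rV[F]_n) :
  \det (1%:M - v *m s) = 1 - (s *m v) 0 0.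
Proof.
have H1 : block_mx 1%:M v s 1%:M =
    block_mx 1%:M 0 s 1%:M *m block_mx 1%:M v 0 (1%:M - s *m v) :> 'M[F]_(n + 1).
  by rewrite mulmx_block !mul1mx !mul0mx !mulmx1 !addr0 [s *m v + _]addrC subrK.
have H2 : block_mx 1%:M v s 1%:M =
    block_mx (1%:M - v *m s) v 0 1%:M *m block_mx 1%:M 0 s 1%:M :> 'M[F]_(n + 1).
  by rewrite mulmx_block !mul1mx !mul0mx !mulmx1 !mulmx0 subrK ?add0r ?addr0.
have := congr1 determinant H1; rewrite {1}H2 !det_mulmx det_lblock !det_ublock !det1 !mul1r !mulr1.
by move=> ->; rewrite det_mx11 !mxE eqxx.
Qed.

(* With [S = diag (eta i + eta j)], the displacement equation [S M + M S = 2 eta_i M +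
   eta M + M eta = 2 eta_i M + lam lam^T] turns [S (1 + B M)] into
   [(1 + M) S - lam lam^T], a rank one perturbation. *)
Section cauchy_like.
Variables (F : fieldType) (n : nat) (eta lam : 'I_n -> F).
Hypothesis eta_neq0 : forall i j, eta i + eta j != 0.

Let M := \matrix_(j < n, k < n) (lam j * lam k / (eta j + eta k)).
Let B (i : 'I_n) := diag_mx (\row_(j < n) ((eta i - eta j) / (eta i + eta j))).

Lemma det_cauchy_like (psi : 'I_n -> F) (i : 'I_n) :
  (forall j, psi j + \sum_k M j k * psi k = lam j) ->
  lam i * \det (1%:M + B i *m M) = psi i * \det (1%:M + M).
Proof.
move=> psiE.
pose S := diag_mx (\row_j (eta i + eta j)).
pose l := \col_j lam j; pose p := \col_j psi j.
pose s := \row_j (lam j / (eta i + eta j)).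
have pE : (1%:M + M) *m p = l.
  apply/matrixP => j k; rewrite mulmxDl mul1mx !mxE -[RHS](psiE j); congr (_ + _).
  by apply: eq_bigr => m _; rewrite !mxE.
have detS : \det S != 0.
  by rewrite det_diag; apply/prodf_neq0 => j _; rewrite mxE.
have SBM : S *m (1%:M + B i *m M) = (1%:M + M) *m (1%:M - p *m s) *m S.
  rewrite mulmxBr mulmx1 mulmxA pE.
  apply/matrixP => j k; rewrite mulmxBl mulmxDl mul1mx mulmxDr mulmx1.
  rewrite /S /B !mul_diag_mx !mul_mx_diag !mxE big_ord1 !mxE.
  have H1 := eta_neq0 i j; have H2 := eta_neq0 i k; have H3 := eta_neq0 j k.
  case: eqVneq => [->|jk]; rewrite ?mulr1n ?mulr0n; field; rewrite ?H1 ?H2 ?H3 ?eta_neq0//.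
have := congr1 determinant SBM; rewrite !det_mulmx det_1B_rank1 mulrC => /(mulIf detS) ->.
rewrite mulrCA mulrC; congr (_ * _).
rewrite -[in RHS](addrK (\sum_k M i k * psi k) (psi i)) psiE mulrBr mulr1; congr (_ - _).
rewrite !mxE mulr_sumr; apply: eq_bigr => k _; rewrite !mxE.
by rewrite mulrA [lam i * (_ / _)]mulrA.
Qed.

End cauchy_like.

Lemma det_1D_psd_neq0 (R : realFieldType) (n : nat) (M : 'M[R]_n) :
  (forall v : 'rV[R]_n, 0 <= (v *m M *m v^T) 0 0) -> \det (1%:M + M) != 0.
Proof.
move=> Mpsd; apply/negP => /det0P[v v0 vM].
have := congr1 (fun A => (A *m v^T) 0 0) vM.
rewrite /= mulmxDr mulmx1 mulmxDl mul0mx mxE [RHS]mxE => /eqP.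
have vv : (v *m v^T) 0 0 = \sum_i v 0 i ^+ 2.
  by rewrite mxE; apply: eq_bigr => i _; rewrite mxE.
have vv0 : 0 <= \sum_i v 0 i ^+ 2 by apply: sumr_ge0 => i _; exact: sqr_ge0.
rewrite vv paddr_eq0// => /andP[/eqP vs _]; move/negP: v0; apply.
apply/eqP/rowP => i; rewrite mxE; apply/eqP; rewrite -sqrf_eq0.
move/eqP: vs; rewrite psumr_eq0 => [|j _]; last exact: sqr_ge0.
by move/allP/(_ i (mem_index_enum i)).
Qed.

Section algebraic_identities.
Variables (F : numFieldType) (n : nat) (eta lam psi psi' : 'I_n -> F).
Hypothesis eta_neq0 : forall i j, eta i + eta j != 0.

Let m i k := lam i * lam k / (eta i + eta k).
Let g i := lam i - \sum_k m i k * psi k - psi i.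
Let g' i := eta i * lam i - \sum_k (lam i * lam k * psi k + m i k * psi' k) - psi' i.

Lemma defect_identity :
  \sum_k (psi' k * g k - psi k * g' k + 2 * eta k * psi k * g k) =
  \sum_k (eta k * lam k * psi k + lam k * psi' k) - 2 * \sum_k eta k * psi k ^+ 2.
Proof.
have mC i k : m i k = m k i by rewrite /m mulrC (addrC (eta k)) [lam k * _]mulrC mulrC.
pose S1 := \sum_k \sum_j psi' k * (m k j * psi j).
pose S2 := \sum_k \sum_j psi k * (m k j * psi' j).
pose S3 := \sum_k \sum_j eta k * psi k * (m k j * psi j).
pose S4 := \sum_k \sum_j psi k * (lam k * lam j * psi j).
have S12 : S1 = S2.
  rewrite /S1 exchange_big; apply: eq_bigr => k _; apply: eq_bigr => j _.
  by rewrite mC; ring.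
have S34 : 2 * S3 = S4.
  rewrite (_ : 2 * S3 = S3 + S3); last by rewrite mulr_natl mulr2n.
  rewrite {1}/S3 exchange_big /S3 -big_split; apply: eq_bigr => k _.
  rewrite -big_split; apply: eq_bigr => j _ /=.
  by rewrite (mC j k) /m; field; exact: eta_neq0.
pose P1 := \sum_k psi' k * lam k. pose P2 := \sum_k psi k * psi' k.
pose P3 := \sum_k eta k * lam k * psi k. pose P4 := \sum_k eta k * psi k ^+ 2.
have E1 : \sum_k psi' k * g k = P1 - S1 - P2.
  rewrite -!sumrB; apply: eq_bigr => k _; rewrite /g -mulr_sumr; ring.
have E2 : \sum_k psi k * g' k = P3 - (S4 + S2) - P2.
  rewrite -big_split -!sumrB; apply: eq_bigr => k _ /=.
  rewrite /g' -!mulr_sumr -mulrDr -big_split /=; ring.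
have E3 : \sum_k 2 * eta k * psi k * g k = 2 * (P3 - S3 - P4).
  rewrite -!sumrB mulr_sumr; apply: eq_bigr => k _; rewrite /g -mulr_sumr; ring.
rewrite big_split sumrB /= E1 E2 E3 big_split /=.
have -> : \sum_k lam k * psi' k = P1 by apply: eq_bigr => k _; rewrite mulrC.
rewrite -/P3 -/P4 -S34 S12; ring.
Qed.

Lemma second_derivative_identity (V : F) (i : 'I_n) :
  V = 4 * \sum_k eta k * psi k ^+ 2 ->
  eta i * (eta i * lam i) - \sum_k ((eta i + eta k) * (lam i * lam k) * psi k +
    lam i * lam k * psi' k + (lam i * lam k * psi' k + m i k * ((eta k ^+ 2 - V) * psi k)))
    - (eta i ^+ 2 - V) * psi i =
  (eta i ^+ 2 - V) * g i - 2 * lam i *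
    \sum_k (psi' k * g k - psi k * g' k + 2 * eta k * psi k * g k).
Proof.
move=> VE; rewrite defect_identity.
rewrite (eq_bigr (fun k => (eta i ^+ 2 - V) * (m i k * psi k) +
    2 * lam i * (eta k * lam k * psi k + lam k * psi' k))); last first.
  by move=> k _; rewrite /m; field; exact: eta_neq0.
rewrite big_split /= -!mulr_sumr /g.
move: VE; set s := \sum_k _ * _ ^+ 2 => ->; ring.
Qed.
End algebraic_identities.

(** * The soliton system *)

Section bounds.
Context {R : realType}.
Implicit Types (f : R -> R) (x X : R).
Notation mu := (@lebesgue_measure R).

Lemma bounded_left f l : continuous f -> f x @[x --> -oo] --> (l : R) ->
  forall X, exists2 Q : R, 0 <= Q & forall x, x <= X -> `|f x| <= Q.
Proof.
move=> cf fl X.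
have [M [_ HM]] : \forall x \near -oo, `|f x| <= `|l| + 1.
  have := cvgr_le `|l| (cvg_norm fl); apply; lra.
have [Q HQ] := bounded_itv_continuous (M - 1) X cf.
exists (`|l| + 1 + `|Q|) => [|x xX]; first by rewrite addr_ge0// addr_ge0.
have [xM|Mx] := ltP x M.
  by rewrite (le_trans (HM _ xM))// lerDl.
rewrite (le_trans (HQ x _))//; first by rewrite in_itv/= xX andbT; lra.
by rewrite (le_trans (ler_norm Q))// lerDr addr_ge0.
Qed.

Lemma extend_exp_bound f (K d X : R) : 0 < d -> continuous f ->
  (forall x, x <= X -> f x <= K * expR (d * x)) ->
  forall Y, exists2 K', 0 <= K' & forall x, x <= Y -> f x <= K' * expR (d * x).
Proof.
move=> d0 cf fK Y; have [M HM] := bounded_itv_continuous X Y cf.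
exists (`|K| + `|M| * expR (- (d * X))) => [|x xY].
  by rewrite addr_ge0// mulr_ge0 ?expR_ge0.
have [xX|Xx] := leP x X.
  rewrite (le_trans (fK _ xX))// ler_wpM2r ?expR_ge0//.
  by rewrite (le_trans (ler_norm K))// lerDl mulr_ge0 ?expR_ge0.
have xI : x \in `[X, Y] by rewrite in_itv/= xY ltW.
rewrite (le_trans (ler_norm _))// (le_trans (HM _ xI))// (le_trans (ler_norm M))//.
rewrite mulrDl -[leLHS]add0r lerD ?mulr_ge0 ?expR_ge0//.
rewrite -mulrA -expRD ler_peMr// -expR0 ler_expR; nra.
Qed.

Lemma exists_pos_lower_bound n (eta : 'I_n -> R) : (forall i, 0 < eta i) ->
  exists2 d, 0 < d & forall i, d <= eta i.
Proof.
move=> eta0; have s0 : 0 <= \sum_i (eta i)^-1.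
  by apply: sumr_ge0 => i _; rewrite invr_ge0 ltW.
exists (1 + \sum_i (eta i)^-1)^-1 => [|i]; first by rewrite invr_gt0 ltr_wpDr.
rewrite -[leRHS]invrK lef_pV2 ?posrE ?invr_gt0 ?ltr_wpDr//.
rewrite (bigD1 i)//= addrCA lerDl addr_ge0// sumr_ge0// => j _.
by rewrite invr_ge0 ltW.
Qed.

Lemma primitive_ge f (K : R) : (forall a b, \int[mu]_(x in `[a, b]) f x <= K) ->
  forall x, x <= 0 -> - K <= primitive f 0 x.
Proof.
move=> fK x x0; rewrite /primitive; case: (leP 0 x) => [x0'|_]; last by rewrite lerN2.
have -> : x = 0 by apply/eqP; rewrite eq_le x0.
have := fK 0 0; rewrite set_itv1 Rintegral_set1; lra.
Qed.

Lemma sobolev_bounded_left (w w' : R -> R) (K : R) : continuous w' ->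
  (forall x, is_derive x 1 w (w' x)) ->
  (forall a b, \int[mu]_(x in `[a, b]) (w x ^+ 2 + w' x ^+ 2) <= K) ->
  exists M, forall x, x <= 0 -> w x ^+ 2 <= M.
Proof.
move=> cw' dw intK.
have cw : continuous w by move=> x; exact: is_derive_continuous (dw x).
have cE : continuous (fun x => w x ^+ 2 + w' x ^+ 2).
  by move=> x; apply: cvgD; [exact: (cvgM (cw x) (cw x))|exact: (cvgM (cw' x) (cw' x))].
have dP x := is_derive_primitive 0 x (continuous_loc_integrable cE) cE.
have dh x := is_derive1D (is_derive1X 2 (dw x)) (dP x).
have Ple := primitive_ge intK.
exists (w 0 ^+ 2 + primitive (fun x => w x ^+ 2 + w' x ^+ 2) 0 0 + K) => x x0.
have := nondecreasing_derive dh _ x0 (lexx 0).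
have H y : y <= 0 -> 0 <= 2%:R * w y ^+ 2.-1 * w' y + (w y ^+ 2 + w' y ^+ 2).
  by move=> _; rewrite /= expr1; have := sqr_ge0 (w y + w' y); lra.
by move=> /(_ H); have := Ple x x0; lra.
Qed.

Lemma sobolev_decay (w w' q : R -> R) (C K : R) : continuous q ->
  (forall x, is_derive x 1 w (w' x)) -> (forall x, is_derive x 1 w' (q x * w x)) ->
  (forall x, x <= 0 -> `|q x| <= C) ->
  (forall a b, \int[mu]_(x in `[a, b]) (w x ^+ 2 + w' x ^+ 2) <= K) ->
  w x @[x --> -oo] --> (0 : R) /\ w' x @[x --> -oo] --> (0 : R).
Proof.
move=> cq dw dw' qC intK.
have cw : continuous w by move=> x; exact: is_derive_continuous (dw x).
have cw' : continuous w' by move=> x; exact: is_derive_continuous (dw' x).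
have cE : continuous (fun x => w x ^+ 2 + w' x ^+ 2).
  by move=> x; apply: cvgD; [exact: (cvgM (cw x) (cw x))|exact: (cvgM (cw' x) (cw' x))].
have dP x := is_derive_primitive 0 x (continuous_loc_integrable cE) cE.
have dE x := is_derive1D (is_derive1X 2 (dw x)) (is_derive1X 2 (dw' x)).
have C0 : 0 <= C by exact: le_trans (qC 0 (lexx 0)).
have E0 : w x ^+ 2 + w' x ^+ 2 @[x --> -oo] --> (0 : R).
  apply: (@decay_of_integrable _ _ _ _ (1 + C) (- K) dP dE) => //.
  - by move=> x; rewrite addr_ge0 ?sqr_ge0.
  - by rewrite addr_ge0.
  - move=> x x0; rewrite /= !expr1; have := qC x x0; rewrite ler_norml => /andP[q1 q2].
    have p1 : 0 <= (C - q x) * (w x + w' x) ^+ 2 by rewrite mulr_ge0 ?sqr_ge0// subr_ge0.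
    have p2 : 0 <= (C + q x) * (w x - w' x) ^+ 2 by rewrite mulr_ge0 ?sqr_ge0//; lra.
    by have := sqr_ge0 (w x - w' x); lra.
  - exact: primitive_ge.
have sE0 : Num.sqrt (w x ^+ 2 + w' x ^+ 2) @[x --> -oo] --> (0 : R).
  by rewrite -(@sqrtr0 R); apply: continuous_cvg => //; exact: sqrt_continuous.
have sEN : - Num.sqrt (w x ^+ 2 + w' x ^+ 2) @[x --> -oo] --> (0 : R).
  by rewrite -oppr0; exact: cvgN.
split; apply: (squeeze_cvgr _ sEN sE0); near=> x; rewrite -ler_norml -sqrtr_sqr ler_sqrt.
all: rewrite ?lerDl ?lerDr ?addr_ge0 ?sqr_ge0//.
Unshelve. all: by end_near. Qed.
End bounds.

Section solution.
Context {R : realType}.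
Variables (N : nat) (eta : 'I_N -> R) (w w' : 'I_N -> R -> R).
Notation mu := (@lebesgue_measure R).
Let V x := 2 * \sum_(j < N) w j x ^+ 2.
Hypotheses (eta0 : forall i, 0 < eta i) (dw : forall i (x : R), is_derive x 1 (w i) (w' i x)).
Hypothesis dw' : forall i (x : R), is_derive x 1 (w' i) ((eta i ^+ 2 - V x) * w i x).
Hypothesis w_bounded : forall i, exists K, forall a b,
  \int[mu]_(x in `[a, b]) (w i x ^+ 2 + w' i x ^+ 2) <= K.
Hypothesis w_neq0 : forall i, ~ (forall x, w i x = 0).

Let w_continuous i : continuous (w i).
Proof. by move=> x; exact: is_derive_continuous (dw i x). Qed.

Let w'_continuous i : continuous (w' i).
Proof. by move=> x; exact: is_derive_continuous (dw' i x). Qed.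

Let V_continuous : continuous V.
Proof.
have c2 j : continuous (fun x => w j x ^+ 2).
  by move=> x; exact: (cvgM (@w_continuous j x) (@w_continuous j x)).
have cs : continuous (fun x => \sum_(j < N) w j x ^+ 2).
  by apply: continuous_big => //; exact: add_continuous.
by move=> x; apply: cvgM; [exact: cvg_cst|exact: cs].
Qed.

Let V_ge0 x : 0 <= V x.
Proof. by rewrite mulr_ge0// sumr_ge0// => j _; exact: sqr_ge0. Qed.

Lemma solution_decay i : w i x @[x --> -oo] --> (0 : R) /\ w' i x @[x --> -oo] --> (0 : R).
Proof.
have /boolp.choice[M HM] : forall j, exists M, forall x, x <= 0 -> w j x ^+ 2 <= M.
  move=> j; have [K HK] := w_bounded j.
  exact: sobolev_bounded_left (@w'_continuous j) (dw j) HK.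
have [K HK] := w_bounded i.
apply: (@sobolev_decay _ (w i) (w' i) (fun x => eta i ^+ 2 - V x)
  (eta i ^+ 2 + 2 * \sum_j M j) K) => //.
  by move=> x; apply: cvgB; [exact: cvg_cst|exact: V_continuous].
move=> x x0; rewrite (le_trans (ler_normB _ _))// !ger0_norm ?sqr_ge0// lerD2l ler_wpM2l//.
by apply: ler_sum => j _; exact: HM.
Qed.

Let V_cvg0 : V x @[x --> -oo] --> (0 : R).
Proof.
rewrite -[X in _ --> X](_ : 2 * \sum_(j < N) (0 * 0) = 0); last first.
  by rewrite big1 ?mulr0// => j _; rewrite mulr0.
apply: cvgM; first exact: cvg_cst.
apply: cvg_big; first exact: add_continuous.
by move=> j _; have [wl _] := solution_decay j; exact: cvgM.
Qed.

Lemma solution_asymptotics : exists (a : 'I_N -> R) (d : R),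
  [/\ 0 < d, forall i, d <= eta i, forall i, a i != 0,
      forall Y, exists2 K, 0 <= K & forall x, x <= Y -> V x <= K * expR (d * x) &
      forall i, expR (- eta i * x) * w i x @[x --> -oo] --> a i /\
        expR (- eta i * x) * w' i x @[x --> -oo] --> (eta i * a i : R)].
Proof.
have [d d0 dle] := exists_pos_lower_bound eta0.
have [X [X0 VX]] : exists X, X <= 0 /\ forall x, x <= X -> forall i, V x <= eta i ^+ 2 / 2.
  have H : \forall x \near -oo, forall i, V x <= eta i ^+ 2 / 2.
    apply: filter_forall => i; apply: (cvgr_le 0 V_cvg0).
    by rewrite divr_gt0// exprn_gt0.
  have [M [_ HM]] := H; exists (Num.min 0 (M - 1)); split; first by rewrite ge_min lexx.
  by move=> x; rewrite le_min => /andP[_ xM]; apply: HM; lra.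
have /boolp.choice[C HC] : forall i, exists C, forall x, x <= X ->
    w i x ^+ 2 <= C * expR (eta i * x).
  move=> i; have [wl w'l] := solution_decay i.
  by apply: (decaying_sqr_le (eta0 i) (dw i) (dw' i)) => // x xX; exact: VX.
have VK x : x <= X -> V x <= 2 * (\sum_i `|C i|) * expR (d * x).
  move=> xX; rewrite -mulrA ler_wpM2l// mulr_suml; apply: ler_sum => i _.
  rewrite (le_trans (HC i x xX))// (le_trans (ler_wpM2r (expR_ge0 _) (ler_norm (C i))))//.
  by rewrite ler_wpM2l// ler_expR ler_wnM2r// (le_trans xX).
have Vext := extend_exp_bound d0 V_continuous VK.
have /boolp.choice[a Ha] : forall i, exists ai,
    [/\ expR (- eta i * x) * w i x @[x --> -oo] --> ai,
     expR (- eta i * x) * w' i x @[x --> -oo] --> (eta i * ai : R) &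
     ai = 0 -> forall x, x <= X -> w i x = 0 /\ w' i x = 0].
  move=> i; have [wl w'l] := solution_decay i.
  have [K K0 HK] := Vext X.
  apply: (decaying_asymptotics (eta0 i) (dw i) (dw' i)) d0 K0 HK _ => // x xX.
  by apply: (decaying_ww'_ge0 (dw i) (dw' i) wl w'l _ xX) => y yX; exact: VX.
exists a, d; split=> //; last by move=> i; have [] := Ha i.
move=> i; apply/eqP => ai0; have [_ _ /(_ ai0) wX] := Ha i.
apply: (@w_neq0 i) => x; have [xX|Xx] := leP x X; first by have [] := wX x xX.
have [wX0 w'X0] := wX X (lexx X).
apply: (second_order_unique (dw i) (dw' i) _ wX0 w'X0) (ltW Xx).
by move=> y; apply: cvgB; [exact: cvg_cst|exact: V_continuous].
Qed.
End solution.

(* [g] is the defect of the linear system [psi + M psi = lam]. By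
   [second_derivative_identity] it solves [g'' = (eta^2 - V) g - 2 lam e] with [e]
   linear in [(g, g')]; [A] and [B] are its modes, rescaled so as to tend to 0. *)
Section linearization.
Context {R : realType}.
Variables (n : nat) (eta c : 'I_n -> R) (psi psi' : 'I_n -> R -> R) (d : R).
Let V (x : R) := 4 * \sum_(k < n) eta k * psi k x ^+ 2.
Hypotheses (d0 : 0 < d) (d_le : forall i, d <= eta i).
Hypothesis dpsi : forall i (x : R), is_derive x 1 (psi i) (psi' i x).
Hypothesis dpsi' : forall i (x : R), is_derive x 1 (psi' i) ((eta i ^+ 2 - V x) * psi i x).
Hypothesis V_exp : forall Y, exists2 K, 0 <= K & forall x, x <= Y -> V x <= K * expR (d * x).
Hypothesis psi_lim : forall i, expR (- eta i * x) * psi i x @[x --> -oo] --> (c i : R).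
Hypothesis psi'_lim : forall i, expR (- eta i * x) * psi' i x @[x --> -oo] --> (eta i * c i : R).

Let lam i (x : R) := c i * expR (eta i * x).
Let m i k (x : R) := lam i x * lam k x / (eta i + eta k).

Let eta0 i : 0 < eta i. Proof. exact: lt_le_trans d0 (d_le i). Qed.

Let etaD_neq0 i k : eta i + eta k != 0.
Proof. by rewrite gt_eqF// addr_gt0. Qed.

Let lam_cvg0 i : lam i x @[x --> -oo] --> (0 : R).
Proof. by rewrite -(mulr0 (c i)); apply: cvgM; [exact: cvg_cst|exact: expR_cvgNy]. Qed.

Let cvg0_of_exp (f : R -> R) (i : 'I_n) (l : R) :
  expR (- eta i * x) * f x @[x --> -oo] --> l -> f x @[x --> -oo] --> (0 : R).
Proof.
move=> fl; rewrite -(mul0r l).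
apply: eq_cvg_fun (cvgM (expR_cvgNy (eta0 i)) fl) _ => x.
by rewrite mulrA -expRD -mulrDl subrr mul0r expR0 mul1r.
Qed.

Let psi_cvg0 i : psi i x @[x --> -oo] --> (0 : R).
Proof. exact: cvg0_of_exp (@psi_lim i). Qed.

Let psi'_cvg0 i : psi' i x @[x --> -oo] --> (0 : R).
Proof. exact: cvg0_of_exp (@psi'_lim i). Qed.

Let dlam i (x : R) : is_derive x 1 (lam i) (eta i * lam i x).
Proof. by rewrite /lam mulrCA; exact: is_derive1Z (is_derive1_exp x (eta i)). Qed.

Let dlam2 i k (x : R) :
  is_derive x 1 (fun y => lam i y * lam k y) ((eta i + eta k) * (lam i x * lam k x)).
Proof. by apply: is_derive_eq (is_derive1M (dlam i x) (dlam k x)) _; ring. Qed.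

Let dm i k (x : R) : is_derive x 1 (m i k) (lam i x * lam k x).
Proof.
apply: is_derive_eq (is_derive1M (dlam2 i k x) (is_derive_cst (eta i + eta k)^-1 x 1)) _.
by rewrite mulr0 addr0 mulrAC divff ?mul1r.
Qed.

Let g i x := lam i x - \sum_k m i k x * psi k x - psi i x.
Let g' i x := eta i * lam i x -
  \sum_k (lam i x * lam k x * psi k x + m i k x * psi' k x) - psi' i x.
Let e x := \sum_k (psi' k x * g k x - psi k x * g' k x + 2 * eta k * psi k x * g k x).

Let dg i (x : R) : is_derive x 1 (g i) (g' i x).
Proof.
apply: is_derive1B (dpsi i x); apply: is_derive1B (dlam i x) _.
by apply: is_derive1_sum => k; exact: is_derive1M (dm i k x) (dpsi k x).
Qed.

Let dg' i (x : R) : is_derive x 1 (g' i) ((eta i ^+ 2 - V x) * g i x - 2 * lam i x * e x).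
Proof.
rewrite /g /g' /e -(second_derivative_identity (fun j => lam j x) (fun j => psi' j x)
   etaD_neq0 i (erefl (V x))).
apply: is_derive1B (dpsi' i x); apply: is_derive1B; first exact: is_derive1Z (dlam i x).
apply: is_derive1_sum => k; apply: is_derive1D.
  exact: is_derive1M (dlam2 i k x) (dpsi k x).
exact: is_derive1M (dm i k x) (dpsi' k x).
Qed.

Let A i (x : R) := expR (- eta i * x) * (g' i x + eta i * g i x).
Let B i (x : R) := expR (- eta i * x) * (g' i x - eta i * g i x).
Let f i (x : R) := expR (- eta i * x) * (- V x * g i x - 2 * lam i x * e x).

Let dA i (x : R) : is_derive x 1 (A i) (f i x).
Proof.
apply: is_derive_eq (is_derive1M (is_derive1_exp x (- eta i))
   (is_derive1D (dg' i x) (is_derive1Z (eta i) (dg i x)))) _.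
by rewrite /f; move: (e x) (g i x) (g' i x) (lam i x) (V x) => *; ring.
Qed.

Let dB i (x : R) : is_derive x 1 (B i) (- (2 * eta i) * B i x + f i x).
Proof.
apply: is_derive_eq (is_derive1M (is_derive1_exp x (- eta i))
   (is_derive1B (dg' i x) (is_derive1Z (eta i) (dg i x)))) _.
by rewrite /f /B; move: (e x) (g i x) (g' i x) (lam i x) (V x) => *; ring.
Qed.

Let expg_cvg0 i : expR (- eta i * x) * g i x @[x --> -oo] --> (0 : R).
Proof.
have H : c i - \sum_k c i / (eta i + eta k) * (lam k x * psi k x) -
    expR (- eta i * x) * psi i x @[x --> -oo] -->
    (c i - \sum_(k < n) c i / (eta i + eta k) * (0 * 0) - c i : R).
  apply: cvgB (@psi_lim i); apply: cvgB; first exact: cvg_cst.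
  apply: cvg_big; first exact: add_continuous.
  move=> k _; apply: cvgM; first exact: cvg_cst.
  by apply: cvgM; [exact: lam_cvg0|exact: psi_cvg0].
rewrite big1 ?subr0 ?subrr in H; last by move=> k _; rewrite !mulr0.
apply: eq_cvg_fun H _ => x.
rewrite /g !mulrBr mulr_sumr; congr (_ - _ - _).
  by rewrite /lam mulrCA -expRD -mulrDl addNr mul0r expR0 mulr1.
apply: eq_bigr => k _; rewrite /m /lam.
rewrite (_ : c i / (eta i + eta k) * (c k * expR (eta k * x) * psi k x) =
  (expR (- eta i * x) * expR (eta i * x)) *
  (c i / (eta i + eta k) * (c k * expR (eta k * x) * psi k x))); last first.
  by rewrite -expRD -mulrDl addNr mul0r expR0 mul1r.
ring.
Qed.

Let expg'_cvg0 i : expR (- eta i * x) * g' i x @[x --> -oo] --> (0 : R).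
Proof.
have H : eta i * c i - \sum_k (c i * (lam k x * psi k x) +
      c i / (eta i + eta k) * (lam k x * psi' k x)) -
    expR (- eta i * x) * psi' i x @[x --> -oo] -->
    (eta i * c i - \sum_(k < n) (c i * (0 * 0) + c i / (eta i + eta k) * (0 * 0)) -
     eta i * c i : R).
  apply: cvgB (@psi'_lim i); apply: cvgB; first exact: cvg_cst.
  apply: cvg_big; first exact: add_continuous.
  move=> k _; apply: cvgD; apply: cvgM; try exact: cvg_cst.
    by apply: cvgM; [exact: lam_cvg0|exact: psi_cvg0].
  by apply: cvgM; [exact: lam_cvg0|exact: psi'_cvg0].
rewrite big1 ?subr0 ?subrr in H; last by move=> k _; rewrite !mulr0 addr0.
apply: eq_cvg_fun H _ => x.
have E : expR (- eta i * x) * expR (eta i * x) = 1.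
  by rewrite -expRD -mulrDl addNr mul0r expR0.
rewrite /g' !mulrBr mulr_sumr; congr (_ - _ - _).
  by rewrite /lam -[LHS]mul1r -E; ring.
apply: eq_bigr => k _; rewrite /m /lam -[LHS]mul1r -E; ring.
Qed.

Let A_cvg0 i : A i x @[x --> -oo] --> (0 : R).
Proof.
have H : expR (- eta i * x) * g' i x + eta i * (expR (- eta i * x) * g i x) @[x --> -oo] -->
   (0 + eta i * 0 : R).
  by apply: cvgD (@expg'_cvg0 i) _; apply: cvgM (@expg_cvg0 i); exact: cvg_cst.
rewrite mulr0 addr0 in H; apply: eq_cvg_fun H _ => x; rewrite /A; ring.
Qed.

Let B_cvg0 i : B i x @[x --> -oo] --> (0 : R).
Proof.
have H : expR (- eta i * x) * g' i x - eta i * (expR (- eta i * x) * g i x) @[x --> -oo] -->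
   (0 - eta i * 0 : R).
  by apply: cvgB (@expg'_cvg0 i) _; apply: cvgM (@expg_cvg0 i); exact: cvg_cst.
rewrite mulr0 subr0 in H; apply: eq_cvg_fun H _ => x; rewrite /B; ring.
Qed.

Let T x := \sum_j (`|A j x| + `|B j x|).

Let V_ge0 x : 0 <= V x.
Proof. by rewrite mulr_ge0// sumr_ge0// => j _; rewrite mulr_ge0 ?sqr_ge0 ?ltW. Qed.

Let e_le X : exists2 D : R, 0 <= D & forall x, x <= X -> `|e x| <= D * expR (d * x) * T x.
Proof.
have bnd k : exists q : R, forall x, x <= X -> `|psi k x| <= q /\ `|psi' k x| <= q.
  have cp : continuous (psi k) by move=> x; exact: is_derive_continuous (dpsi k x).
  have cp' : continuous (psi' k) by move=> x; exact: is_derive_continuous (dpsi' k x).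
  have [q1 _ H1] := bounded_left cp (@psi_cvg0 k) X.
  have [q2 _ H2] := bounded_left cp' (@psi'_cvg0 k) X.
  exists (Num.max q1 q2) => x xX.
  by rewrite !le_max H1// H2// orbT.
have /boolp.choice[q Hq] := bnd.
pose a k := `|q k| / (2 * eta k) + `|q k| / 2 + `|q k|.
have a0 k : 0 <= a k.
  by rewrite !addr_ge0// divr_ge0// mulr_ge0// ltW.
pose D k := expR ((eta k - d) * X) * a k.
have D0 k : 0 <= D k by rewrite mulr_ge0 ?expR_ge0.
exists (\sum_k D k) => [|x xX]; first exact: sumr_ge0.
rewrite /T mulr_sumr (le_trans (ler_norm_sum _ _ _))//; apply: ler_sum => k _.
have [p1 p2] := Hq k x xX.
have {}p1 := le_trans p1 (ler_norm _); have {}p2 := le_trans p2 (ler_norm _).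
have E1 : expR (eta k * x) * expR (- eta k * x) = 1.
  by rewrite -expRD -mulrDl subrr mul0r expR0.
have ek : eta k != 0 by rewrite gt_eqF.
set t := `|A k x| + `|B k x|.
have t0 : 0 <= t by rewrite addr_ge0.
have gE : g k x = expR (eta k * x) * ((A k x - B k x) / (2 * eta k)).
  rewrite -[LHS]mul1r -[X in X * _ = _]E1 /A /B.
  by move: (g k x) (g' k x) => u v; field.
have g'E : g' k x = expR (eta k * x) * ((A k x + B k x) / 2).
  rewrite -[LHS]mul1r -[X in X * _ = _]E1 /A /B.
  by move: (g k x) (g' k x) => u v; field.
have gle : `|g k x| <= expR (eta k * x) * (t / (2 * eta k)).
  rewrite gE normrM ger0_norm ?expR_ge0// ler_wpM2l ?expR_ge0//.
  rewrite normrM (ger0_norm (x := _^-1)) ?invr_ge0 ?mulr_ge0 ?(ltW (eta0 k))//.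
  by rewrite ler_wpM2r ?ler_normB// invr_ge0 mulr_ge0// ltW.
have g'le : `|g' k x| <= expR (eta k * x) * (t / 2).
  rewrite g'E normrM ger0_norm ?expR_ge0// ler_wpM2l ?expR_ge0//.
  by rewrite normrM (ger0_norm (x := _^-1))// ler_wpM2r// ler_normD.
have step : `|psi' k x * g k x - psi k x * g' k x + 2 * eta k * psi k x * g k x| <=
    expR (eta k * x) * a k * t.
  rewrite (le_trans (ler_normD _ _))// (_ : expR (eta k * x) * a k * t =
    `|q k| * (expR (eta k * x) * (t / (2 * eta k))) + `|q k| * (expR (eta k * x) * (t / 2)) +
    2 * eta k * (`|q k| * (expR (eta k * x) * (t / (2 * eta k))))); last by rewrite /a; field.
  apply: lerD.
    by rewrite (le_trans (ler_normB _ _))// !normrM lerD// ler_pM.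
  rewrite -mulrA normrM ger0_norm ?mulr_ge0 ?(ltW (eta0 k))//.
  by rewrite ler_wpM2l ?mulr_ge0 ?(ltW (eta0 k))// normrM ler_pM.
apply: le_trans step _; rewrite ler_wpM2r//.
apply: (@le_trans _ _ (D k * expR (d * x))); last first.
  by rewrite ler_wpM2r ?expR_ge0// (bigD1 k)//= lerDl sumr_ge0.
rewrite /D [leRHS]mulrAC ler_wpM2r// -expRD ler_expR.
have := d_le k; nra.
Qed.

Let f_le X : exists2 D : R, 0 <= D & forall i x, x <= X -> `|f i x| <= D * expR (d * x) * T x.
Proof.
have [D D0 eD] := e_le X; have [K K0 VK] := V_exp X.
pose a i := K / (2 * eta i) + 2 * `|c i| * D.
have a0 i : 0 <= a i.
  by rewrite addr_ge0 ?divr_ge0 ?mulr_ge0 ?(ltW (eta0 i)).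
exists (\sum_i a i) => [|i x xX]; first exact: sumr_ge0.
have T0 : 0 <= T x by apply: sumr_ge0 => j _; rewrite addr_ge0.
apply: (@le_trans _ _ (a i * expR (d * x) * T x)); last first.
  by rewrite !ler_wpM2r ?expR_ge0// (bigD1 i)//= lerDl sumr_ge0.
have E1 : expR (- eta i * x) * expR (eta i * x) = 1.
  by rewrite -expRD -mulrDl addNr mul0r expR0.
have ei : eta i != 0 by rewrite gt_eqF.
have fE : f i x = - (V x * ((A i x - B i x) / (2 * eta i))) - 2 * c i * e x.
  rewrite (_ : 2 * c i * e x =
    expR (- eta i * x) * expR (eta i * x) * (2 * c i * e x)); last by rewrite E1 mul1r.
  by rewrite /f /A /B /lam; move: (g i x) (g' i x) (e x) (V x) => u v y z; field.
rewrite fE (le_trans (ler_normB _ _))// normrN /a.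
rewrite (_ : _ * T x = K * expR (d * x) * (T x / (2 * eta i)) +
  2 * (`|c i| * (D * expR (d * x) * T x))); last by move: (T x) => t; field.
apply: lerD.
  rewrite normrM (ger0_norm (V_ge0 x)).
  rewrite ler_pM ?VK// normrM (ger0_norm (x := _^-1)) ?invr_ge0 ?mulr_ge0 ?(ltW (eta0 i))//.
  rewrite ler_wpM2r ?invr_ge0 ?mulr_ge0 ?(ltW (eta0 i))//.
  by rewrite (le_trans (ler_normB _ _))// /T (bigD1 i)//= lerDl sumr_ge0// => j _; rewrite addr_ge0.
rewrite -!mulrA normrM ger0_norm// ler_wpM2l// normrM ler_wpM2l//.
by rewrite mulrA; exact: eD.
Qed.

Lemma linear_relation i x : psi i x + \sum_k m i k x * psi k x = lam i x.
Proof.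
have [D D0 fle] := f_le x.
have etaP j : 0 <= 2 * eta j by rewrite mulr_ge0// ltW.
have [A0 B0] := linear_system_vanishing d0 D0 etaP dA dB fle A_cvg0 B_cvg0 i (lexx x).
have := congr2 (fun u v => u - v) A0 B0; rewrite /= subrr /A /B -mulrBr.
move/eqP; rewrite mulf_eq0 gt_eqF ?expR_gt0//= opprB addrC addrA subrK.
rewrite -mulr2n mulrn_eq0/= mulf_eq0 gt_eqF//= /g subr_eq0 subr_eq => /eqP ->.
by rewrite addrC.
Qed.

Lemma cauchy_det_neq0 x : \det (1%:M + \matrix_(j < n, k < n) m j k x) != 0.
Proof.
apply: det_1D_psd_neq0 => v.
pose q y := \sum_j \sum_k v 0 j * v 0 k * m j k y.
have dq (y : R) : is_derive y 1 q ((\sum_j v 0 j * lam j y) ^+ 2).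
  rewrite expr2 big_distrlr /=; apply: is_derive1_sum => j; apply: is_derive1_sum => k.
  by rewrite mulrACA; exact: is_derive1Z (dm j k y).
have q0 : q y @[y --> -oo] --> (0 : R).
  rewrite -[X in _ --> X](_ : \sum_(j < n) \sum_(k < n)
      v 0 j * v 0 k * (0 * 0 / (eta j + eta k)) = 0); last first.
    by rewrite big1// => j _; rewrite big1// => k _; rewrite !mul0r mulr0.
  apply: cvg_big => [|j _]; first exact: add_continuous.
  apply: cvg_big => [|k _]; first exact: add_continuous.
  apply: cvgM; first exact: cvg_cst.
  by apply: cvgM; [apply: cvgM; exact: lam_cvg0|exact: cvg_cst].
have := derive_ge0_limit_le dq (fun y _ => sqr_ge0 _) q0 (lexx x).
congr (_ <= _); rewrite /q mxE exchange_big /=; apply: eq_bigr => k _.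
rewrite !mxE mulr_suml; apply: eq_bigr => j _; rewrite !mxE; ring.
Qed.
End linearization.

Theorem theorem1p1 (R : realType) (N : nat) (hN : (2 <= N)%N)
  (mu : 'I_N -> R)
  (hmu_incr : forall i j : 'I_N, (i < j)%N -> mu i < mu j)
  (hmu_neg : forall i : 'I_N, mu i < 0)
  (u : 'I_N -> R -> R)
  (hu : forall i : 'I_N, H1_nonzero (u i))
  (hsol : distributional_solution mu u) :
  let eta := fun i : 'I_N => Num.sqrt (- mu i) in
  exists a : 'I_N -> R,
    (forall i : 'I_N, a i != 0) /\
    forall i : 'I_N,
      C2_representative (u i) (fun x : R =>
        a i * expR (eta i * x) * \det (1%:M + Bmx eta i *m Mmx eta a x)
        / \det (1%:M + Mmx eta a x)).
Proof.
move=> eta.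
have eta0 i : 0 < eta i by rewrite sqrtr_gt0 oppr_gt0.
have eta2 i : eta i ^+ 2 = - mu i by rewrite sqr_sqrtr// oppr_ge0 ltW.
have [w [w' [uw dw dw' wK]]] := regularity (fun i => (hu i).1) hsol.
have {}dw' i (x : R) :
    is_derive x 1 (w' i) ((eta i ^+ 2 - 2 * \sum_(j < N) w j x ^+ 2) * w i x).
  by rewrite eta2 mulrBl.
have w_neq0 i : ~ (forall x, w i x = 0).
  move=> w0; apply: (hu i).2; apply: filterS (uw i).
    exact: (ae_filter_ringOfSetsType (@lebesgue_measure R)).
  by move=> x ->.
have [a [d [d0 dle a0 Vexp alim]]] := solution_asymptotics eta0 dw dw' wK w_neq0.
exists a; split=> // i.
pose r j : R := Num.sqrt (2 * eta j).
have r0 j : 0 < r j by rewrite sqrtr_gt0 mulr_gt0.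
have r2 j : r j ^+ 2 = 2 * eta j by rewrite sqr_sqrtr// mulr_ge0// ltW.
pose psi j x : R := (r j)^-1 * w j x.
pose psi' j x : R := (r j)^-1 * w' j x.
pose c j : R := (r j)^-1 * a j.
have VE x : 4 * (\sum_(j < N) eta j * psi j x ^+ 2) = 2 * \sum_(j < N) w j x ^+ 2.
  rewrite !mulr_sumr; apply: eq_bigr => j _.
  by rewrite /psi exprMn exprVn r2; field; rewrite gt_eqF.
have dpsi j (x : R) : is_derive x 1 (psi j) (psi' j x) by exact: is_derive1Z (dw j x).
have dpsi' j (x : R) : is_derive x 1 (psi' j)
    ((eta j ^+ 2 - 4 * \sum_(k < N) eta k * psi k x ^+ 2) * psi j x).
  by rewrite VE /psi mulrCA; exact: is_derive1Z (dw' j x).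
have Vexp' Y : exists2 K, 0 <= K &
    forall x, x <= Y -> 4 * (\sum_(j < N) eta j * psi j x ^+ 2) <= K * expR (d * x).
  by have [K K0 HK] := Vexp Y; exists K => // x xY; rewrite VE HK.
have psil j : expR (- eta j * x) * psi j x @[x --> -oo] --> (c j : R).
  apply: eq_cvg_fun (cvgM (cvg_cst (r j)^-1) (alim j).1) _ => x.
  by rewrite /psi [RHS]mulrCA.
have psi'l j : expR (- eta j * x) * psi' j x @[x --> -oo] --> (eta j * c j : R).
  rewrite /c mulrCA; apply: eq_cvg_fun (cvgM (cvg_cst (r j)^-1) (alim j).2) _ => x.
  by rewrite /psi' [RHS]mulrCA.
have rel := linear_relation d0 dle dpsi dpsi' Vexp' psil psi'l.
have etaD j k : eta j + eta k != 0 by rewrite gt_eqF// addr_gt0.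
have ME x : Mmx eta a x = \matrix_(j < N, k < N)
    (c j * expR (eta j * x) * (c k * expR (eta k * x)) / (eta j + eta k)).
  apply/matrixP => j k; rewrite !mxE [(_ + _) * x]mulrDl expRD.
  have -> : 2 * Num.sqrt (eta j * eta k) = r j * r k.
    have -> : r j * r k = Num.sqrt (2 * eta j * (2 * eta k)).
      by rewrite sqrtrM// mulr_ge0// ltW.
    rewrite (_ : 2 * eta j * (2 * eta k) = 2 ^+ 2 * (eta j * eta k)); last by ring.
    by rewrite [RHS]sqrtrM ?sqr_ge0// sqrtr_sqr ger0_norm.
  rewrite /c; field; rewrite etaD !gt_eqF//.
have wE x : a i * expR (eta i * x) * \det (1%:M + Bmx eta i *m Mmx eta a x)
        / \det (1%:M + Mmx eta a x) = w i x.
  have D0 := cauchy_det_neq0 c d0 dle x.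
  have rx j : psi j x + \sum_k (\matrix_(j < N, k < N)
      (c j * expR (eta j * x) * (c k * expR (eta k * x)) / (eta j + eta k))) j k * psi k x =
      c j * expR (eta j * x).
    by rewrite -[RHS]rel; congr (_ + _); apply: eq_bigr => k _; rewrite mxE.
  have := det_cauchy_like etaD i rx; rewrite /Bmx ME => H.
  rewrite (_ : a i * expR (eta i * x) = r i * (c i * expR (eta i * x))); last first.
    by rewrite /c !mulrA mulfV ?mul1r// gt_eqF.
  by rewrite -[r i * _ * _]mulrA H mulrA mulfK// /psi mulrA mulfV ?mul1r// gt_eqF.
have -> : (fun x => a i * expR (eta i * x) * \det (1%:M + Bmx eta i *m Mmx eta a x)
        / \det (1%:M + Mmx eta a x)) = w i by apply/funext.
split; last exact: uw.
have w1 : ((w i)^`())%classic = w' i by apply/funext => x; exact: is_derive1E (dw i x).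
split; first by move=> x; have [] := dw i x.
split; first by rewrite w1 => x; have [] := dw' i x.
have -> : ((w i)^`(2))%classic = fun x => (eta i ^+ 2 - 2 * \sum_(j < N) w j x ^+ 2) * w i x.
  have -> : ((w i)^`(2))%classic = (((w i)^`())^`())%classic by [].
  by rewrite w1; apply/funext => x; exact: is_derive1E (dw' i x).
have cw j : continuous (w j) by move=> x; exact: is_derive_continuous (dw j x).
have cw2 j : continuous (fun x => w j x ^+ 2) by move=> x; exact: (cvgM (cw j x) (cw j x)).
have cs : continuous (fun x => \sum_(j < N) w j x ^+ 2).
  by apply: continuous_big => //; exact: add_continuous.
move=> x; apply: cvgM (cw i x); apply: cvgB; first exact: cvg_cst.
by apply: cvgM; [exact: cvg_cst|exact: cs].
Qed.
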